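(* Let $\mathcal{B}\subset\mathscr{B}(G)$ be a von Neumann algebra acting non-degenerately on a Hilbert space $G$, let $E$ be a von Neumann $\mathcal{B}$-module, let $H=E\odot G$, regard $E\subset\mathscr{B}(G,H)$ and $\mathscr{B}^a(E)\subset\mathscr{B}(H)$ via the canonical identifications, and let $\rho'\colon\mathcal{B}'\to\mathscr{B}(H)$ be the representation $\rho'(b')=\mathrm{id}_E\odot b'$ of the commutant $\mathcal{B}'$ of $\mathcal{B}$. Then $$E=C_{\mathcal{B}'}(\mathscr{B}(G,H))\qquad\text{and}\qquad \mathscr{B}^a(E)=\rho'(\mathcal{B}')',$$ where $C_{\mathcal{B}'}(\mathscr{B}(G,H))=\{x\in\mathscr{B}(G,H)\colon \rho'(b')x=xb'\text{ for all }b'\in\mathcal{B}'\}$ and $\rho'(\mathcal{B}')'$ is the commutant of $\rho'(\mathcal{B}')$ in $\mathscr{B}(H)$.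
   Context: $\mathscr{B}(G)$ denotes all bounded operators on $G$, and $\mathscr{B}(G,H)$ all bounded operators $G\to H$. Inner products are linear in the second argument. Let $E$ be a (right) Hilbert module over $\mathcal{B}\subset\mathscr{B}(G)$. The Hilbert space $H=E\odot G$ is the interior tensor product over $\mathcal{B}$, i.e. the completion of the span of elementary tensors $x\odot g$ ($x\in E$, $g\in G$) with inner product $\langle x_1\odot g_1,x_2\odot g_2\rangle=\langle g_1,\langle x_1,x_2\rangle g_2\rangle$ (modulo null vectors). Every $x\in E$ defines $L_x\in\mathscr{B}(G,H)$, $L_xg=x\odot g$; one has $L_{xb}=L_xb$ and $L_x^*L_y=\langle x,y\rangle$. Via $x\mapsto L_x$ one identifies $E$ with a subspace of $\mathscr{B}(G,H)$. $E$ is called a von Neumann $\mathcal{B}$-module if $E$ is closed in $\mathscr{B}(G,H)$ in the strong operator topology. $\mathscr{B}^a(E)$ is the algebra of adjointable operators on $E$. Each $a\in\mathscr{B}^a(E)$ is identified with the bounded operator on $H$ determined by $x\odot g\mapsto ax\odot g$, so that $\mathscr{B}^a(E)$ is a $*$-subalgebra of $\mathscr{B}(H)$. For $b'\in\mathcal{B}'$, $\rho'(b')=\mathrm{id}_E\odot b'$ is the bounded operator on $H$ determined by $x\odot g\mapsto x\odot b'g$; $\rho'$ is a normal unital representation of $\mathcal{B}'$ on $H$. *)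

(* Defs.v *)
From HB Require Import structures.
From mathcomp Require Import all_boot all_order all_algebra sesquilinear complex.
From mathcomp Require Import all_classical all_reals all_analysis.

Set Implicit Arguments.
Unset Strict Implicit.
Unset Printing Implicit Defensive.

Import Order.TTheory GRing.Theory Num.Theory.
Import numFieldNormedType.Exports.

Local Open Scope ring_scope.
Local Open Scope classical_set_scope.
Local Open Scope complex_scope.

HB.mixin Record CompleteNormedModule_isHilbert (R : realType) H
    & CompleteNormedModule R[i] H := {
  hdot : {dot H for (@Num.conj R[i])} ;
  hdot_norm : forall x : H, hdot x x = `|x| ^+ 2 }.

#[short(type="hilbertType")]
HB.structure Definition Hilbert (R : realType) :=
  {H of CompleteNormedModule_isHilbert R H & CompleteNormedModule R[i] H}.

(* MathComp's {dot _ for _} forms are linear in the FIRST argument; here inner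
   products are linear in the second, hence the swap. *)
Definition inner (R : realType) (H : hilbertType R) (x y : H) : R[i] :=
  hdot y x.

Section Operators.
Variable R : realType.
Implicit Types G H : hilbertType R.

Definition lin_span (V : lmodType R[i]) (A : set V) : set V :=
  [set v | exists (n : nat) (c : 'I_n -> R[i]) (a : 'I_n -> V),
    (forall k, A (a k)) /\ v = \sum_(k < n) c k *: a k].

Definition total_set (V : normedModType R[i]) (A : set V) : Prop :=
  dense (lin_span A).

(* B(G, H); operators are plain functions, and sets of operators are sets of
   functions contained in [bounded_ops]. *)
Definition bounded_ops G H : set (G -> H) :=
  [set f | linear f /\ exists M : R, forall g, `|f g| <= M%:C * `|g|].
Arguments bounded_ops : clear implicits.

Definition opnorm G H (f : G -> H) : R :=
  sup [set complex.Re `|f g| | g in [set g : G | `|g| <= 1]].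

Definition adjoint_ops G H (f : G -> H) (f' : H -> G) : Prop :=
  forall g h, inner h (f g) = inner (f' h) g.

(* Closed in B(G, H) for the strong operator topology, which is the topology of
   pointwise convergence; the closure is taken relative to B(G, H). *)
Definition sot_closed G H (A : set (G -> H)) : Prop :=
  closure (A : set {ptws G -> H}) `&` bounded_ops G H `<=` A.

Definition commutant H (A : set (H -> H)) : set (H -> H) :=
  [set f | bounded_ops H H f /\ forall a, A a -> f \o a = a \o f].

Record von_neumann_algebra G (B : set (G -> G)) : Prop := {
  vna_bounded : B `<=` bounded_ops G G ;
  vna_0 : B 0 ;
  vna_lin : forall (c : R[i]) a b, B a -> B b -> B (c *: a + b) ;
  vna_comp : forall a b, B a -> B b -> B (a \o b) ;
  vna_adj : forall b, B b -> exists2 b', B b' & adjoint_ops b b' ;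
  vna_sot : sot_closed B }.

Definition nondegenerate_on G (B : set (G -> G)) : Prop :=
  total_set [set b g | b in B & g in [set: G]].

(* The action [hm_act x b] = xb is a total function, but only its values for
   b in B matter. [hm_norm] says that the Banach norm of E is the one induced by
   the B-valued inner product, i.e. that E is complete in the latter. *)
Record hilbertModule G (B : set (G -> G)) (E : completeNormedModType R[i]) := {
  hm_act : E -> (G -> G) -> E ;
  hm_inner : E -> E -> G -> G ;
  hm_act_linl : forall b, B b -> linear (hm_act^~ b) ;
  hm_act_linr : forall x (c : R[i]) a b, B a -> B b ->
    hm_act x (c *: a + b) = c *: hm_act x a + hm_act x b ;
  hm_act_comp : forall x a b, B a -> B b ->
    hm_act x (a \o b) = hm_act (hm_act x a) b ;
  hm_innerB : forall x y, B (hm_inner x y) ;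
  hm_inner_lin : forall x, linear (hm_inner x) ;
  hm_inner_adj : forall x y, adjoint_ops (hm_inner x y) (hm_inner y x) ;
  hm_inner_act : forall x y b, B b ->
    hm_inner x (hm_act y b) = hm_inner x y \o b ;
  hm_inner_ge0 : forall x g, 0 <= inner g (hm_inner x x g) ;
  hm_inner_eq0 : forall x, hm_inner x x = 0 -> x = 0 ;
  hm_norm : forall x, `|x| ^+ 2 = (opnorm (hm_inner x x))%:C }.

Definition adjointable G (B : set (G -> G)) (E : completeNormedModType R[i])
    (M : hilbertModule B E) : set (E -> E) :=
  [set a | exists a' : E -> E, forall x y,
    hm_inner M x (a y) = hm_inner M (a' x) y].

(* A completion of the span of the elementary tensors [odot x g] modulo null
   vectors: a Hilbert space H with the prescribed inner products between
   elementary tensors, in which they are total. (Bilinearity of [odot] and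
   xb (.) g = x (.) bg follow from [odot_inner].) H is unique up to a unitary
   preserving elementary tensors, and any such H is allowed. *)
Record interior_tensor G (B : set (G -> G)) (E : completeNormedModType R[i])
    (M : hilbertModule B E) H := {
  odot : E -> G -> H ;
  odot_inner : forall x1 g1 x2 g2,
    inner (odot x1 g1) (odot x2 g2) = inner g1 (hm_inner M x1 x2 g2) ;
  odot_total : total_set [set odot x g | x in [set: E] & g in [set: G]] }.

Section Tensor.
Variables (G H : hilbertType R) (B : set (G -> G)).
Variables (E : completeNormedModType R[i]) (M : hilbertModule B E).
Variable T : interior_tensor M H.

Definition Lop (x : E) : G -> H := fun g => odot T x g.

Definition E_ops : set (G -> H) := range Lop.

Definition von_neumann_module : Prop := sot_closed E_ops.

(* a (.) b', the bounded operator on H determined by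
   x (.) g |-> ax (.) b'g; [get] returns a junk value if there is none. *)
Definition tensor_op (a : E -> E) (b' : G -> G) : H -> H :=
  get [set f : H -> H | bounded_ops H H f /\
    forall x g, f (odot T x g) = odot T (a x) (b' g)].

Definition rho' (b' : G -> G) : H -> H := tensor_op id b'.

Definition Ba_ops : set (H -> H) :=
  [set tensor_op a id | a in adjointable M].

Definition intertwiners : set (G -> H) :=
  [set x | bounded_ops G H x /\
    forall b', commutant B b' -> rho' b' \o x = x \o b'].

End Tensor.

End Operators.

Arguments bounded_ops {R} G H _.

(* Main.v *)
(**
An operator z in the intertwiner space is shown to be a pointwise limit of
elements of E by von Neumann's amplification argument.  Fix v in G^n, let p be
the orthogonal projection of G^n onto the closure of {(b v_i)_i : b in B} and q
that of H^n onto the closure of {(x (.) v_i)_i : x in E}.  Since <x, y> lies in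
B and E B is contained in E, the amplification of every L_x sends the range of
p into that of q and likewise for the orthogonal complements, so
q L_x = L_x p.  The entries of p commute with B and the identity says
q_ij = rho'(p_ij).  Non-degeneracy gives p v = v, whence
z v = z p v = q z v lies in the closure of {(x (.) v_i)_i}.

The second identity follows by applying the first one to f L_x and f^* L_x for
f in the commutant of rho'(B').  The operators id (.) b' and a (.) id exist by
a spectral radius argument, the latter once a is known to be bounded on E,
which is the uniform boundedness principle.
*)

Require Import Defs.
From mathcomp Require Import all_boot all_order all_algebra complex.
From mathcomp Require Import all_classical all_reals all_analysis.
From mathcomp Require Import ring lra.

Set Implicit Arguments.
Unset Strict Implicit.
Unset Printing Implicit Defensive.

Import Order.TTheory GRing.Theory Num.Theory.
Import numFieldNormedType.Exports.

Local Open Scope ring_scope.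
Local Open Scope classical_set_scope.
Local Open Scope complex_scope.

(** * Real-valued norms and the topology of pointwise convergence *)

Lemma ltr0c (R : realType) (t : R) : (0 < t%:C) = (0 < t).
Proof. exact: (ltcR 0). Qed.

Lemma lerc1 (R : realType) (t : R) : (t%:C <= 1) = (t <= 1).
Proof. exact: (lecR _ 1). Qed.

Lemma invn_lt (R : realType) (e : R) : 0 < e ->
  exists n0 : nat, forall n, (n0 <= n)%N -> n.+1%:R^-1 < e.
Proof.
move=> e0; exists (Num.bound e^-1) => n n0n.
rewrite invf_plt ?posrE//; apply: lt_le_trans (archi_boundP _) _.
  by rewrite invr_ge0 ltW.
by rewrite ler_nat (leq_trans n0n).
Qed.

Section RealNorm.
Variables (R : realType) (V : normedModType R[i]).
Implicit Types (x y : V) (t : R).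

(** Norms take values in [R[i]], which is only partially ordered; the real part loses nothing and
    brings estimates into the ordered field [R]. *)
Definition rnorm x : R := complex.Re `|x|.

Lemma rnormE x : `|x| = (rnorm x)%:C.
Proof. by rewrite /rnorm RRe_real. Qed.

Lemma rnorm_ge0 x : 0 <= rnorm x.
Proof. by rewrite -ler0c -rnormE. Qed.

Lemma rnorm0 : rnorm 0 = 0.
Proof. by rewrite /rnorm normr0. Qed.

Lemma rnorm_eq0 x : rnorm x = 0 -> x = 0.
Proof. by move=> x0; apply/normr0_eq0; rewrite rnormE x0. Qed.

Lemma rnorm_gt0 x : x != 0 -> 0 < rnorm x.
Proof.
move=> x0; rewrite lt0r rnorm_ge0 andbT.
by apply: contra x0 => /eqP/rnorm_eq0 ->.
Qed.

Lemma rnormN x : rnorm (- x) = rnorm x.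
Proof. by rewrite /rnorm normrN. Qed.

Lemma rnormB x y : rnorm (x - y) = rnorm (y - x).
Proof. by rewrite -rnormN opprB. Qed.

Lemma rnormD x y : rnorm (x + y) <= rnorm x + rnorm y.
Proof. by rewrite -lecR rmorphD/= -!rnormE ler_normD. Qed.

Lemma rnorm_trans x y z : rnorm (x - z) <= rnorm (x - y) + rnorm (y - z).
Proof. by rewrite -{1}(subrK y x) -addrA rnormD. Qed.

Lemma rnormZ t x : rnorm (t%:C *: x) = `|t| * rnorm x.
Proof.
apply: complexI; rewrite -rnormE normrZ rnormE rmorphM/=; congr (_ * _).
by rewrite normc_def/= expr0n/= addr0 sqrtr_sqr.
Qed.

Lemma nbhs_rnorm x (A : set V) : nbhs x A <->
  exists2 e : R, 0 < e & forall y, rnorm (x - y) < e -> A y.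
Proof.
split=> [/nbhs_ballP[e /= e0 eA]|[e e0 eA]].
  have er : e = (complex.Re e)%:C by rewrite RRe_real// gtr0_real.
  exists (complex.Re e); first by rewrite -ltr0c -er.
  by move=> y xy; apply: eA; rewrite -ball_normE/= rnormE er ltcR.
apply/nbhs_ballP; exists e%:C; first by rewrite /= ltr0c.
by move=> y; rewrite -ball_normE/= rnormE ltcR; exact: eA.
Qed.

Lemma dense_approx (A : set V) x (e : R) : dense A -> 0 < e ->
  exists2 y, A y & rnorm (x - y) < e.
Proof.
move=> dA e0; have /dA : ball x e%:C !=set0.
  by exists x; apply: ballxx; rewrite ltr0c.
case; first by apply: ball_open; rewrite ltr0c.
by move=> y [+ Ay]; rewrite -ball_normE/= rnormE ltcR; exists y.
Qed.

End RealNorm.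

Section Complete.
Variables (R : realType) (V : completeNormedModType R[i]).

(** [N] may be a norm or a squared norm, so the notion serves both [rnorm] and the diagonal of a
    form. *)
Definition seq_complete (T : zmodType) (N : T -> R) := forall u : nat -> T,
  (forall e, 0 < e -> exists n0, forall m n, (n0 <= m)%N -> (n0 <= n)%N ->
     N (u m - u n) < e) ->
  exists l, forall e, 0 < e -> exists n0, forall n, (n0 <= n)%N ->
    N (u n - l) < e.

Lemma rnorm_complete : seq_complete (@rnorm R V).
Proof.
move=> u uC; have /cauchy_cvg : cauchy (u @ \oo).
  apply/cauchy_exP => e e0.
  have er : e = (complex.Re e)%:C by rewrite RRe_real// gtr0_real.
  have [|n0 un0] := uC (complex.Re e); first by rewrite -ltr0c -er.
  exists (u n0); exists n0 => // n /= n0n.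
  by rewrite /= -ball_normE/= rnormE er ltcR; exact: un0.
move=> /cvg_ex[l ul]; exists l => e e0.
have /ul[n0 _ n0P] : nbhs l [set y | rnorm (l - y) < e].
  by apply/nbhs_rnorm; exists e.
by exists n0 => n /n0P; rewrite /= rnormB.
Qed.

End Complete.

Section Operators.
Variables (R : realType) (G H : hilbertType R).
Implicit Types f : G -> H.

Lemma bounded_opsP f : bounded_ops G H f <->
  linear f /\ exists2 M : R, 0 < M & forall g, rnorm (f g) <= M * rnorm g.
Proof.
split=> -[lf [M]].
  move=> fM; split=> //; exists (`|M| + 1); first by rewrite ltr_wpDl.
  move=> g; have := fM g; rewrite !rnormE -rmorphM/= lecR => /le_trans; apply.
  by rewrite ler_wpM2r ?rnorm_ge0// (le_trans (ler_norm _))// lerDl.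
move=> _ fM; split=> //; exists M => g.
by rewrite !rnormE -rmorphM/= lecR.
Qed.

(** The sets of members of [A] that are [e]-close to [z] on a finite list generate a proper filter,
    which contains [A] and converges pointwise to [z]. *)
Lemma ptws_closureP (A : set (G -> H)) z :
  (forall (s : seq G) (e : R), 0 < e ->
    exists2 f, A f & forall g, g \in s -> rnorm (z g - f g) < e) ->
  closure (A : set {ptws G -> H}) z.
Proof.
move=> zA; rewrite closureEcvg.
pose D := [set se : seq G * R | 0 < se.2].
pose N (se : seq G * R) : set (G -> H) :=
  A `&` [set f | forall g, g \in se.1 -> rnorm (z g - f g) < se.2].
have FF : ProperFilter (filter_from D N).
  apply: filter_from_proper; last first.
    by move=> [s e] /zA-/(_ s)[f Af fz]; exists f.
  apply: filter_from_filter; first by exists ([::], 1); rewrite /D/=.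
  move=> [s e] [s' e']; rewrite /D/= => e0 e'0.
  exists (s ++ s', Num.min e e'); first by rewrite /= lt_min e0.
  move=> f [Af fz]; split; split=> // g gs.
    by have := fz g; rewrite /= mem_cat gs lt_min => /(_ isT)/andP[].
  by have := fz g; rewrite /= mem_cat gs orbT lt_min => /(_ isT)/andP[].
exists (filter_from D N) => //; split.
  apply/pointwise_cvgP => g U /= /nbhs_rnorm[e e0 eU].
  exists ([:: g], e) => // f [_ /(_ g)]/=.
  by rewrite inE eqxx => /(_ isT); exact: eU.
by move=> U AU; exists ([::], 1); [rewrite /D/=|move=> f [/AU]].
Qed.

End Operators.

Lemma bounded_ops_comp (R : realType) (G H K : hilbertType R)
    (f : G -> H) (f' : H -> K) :
  bounded_ops H K f' -> bounded_ops G H f -> bounded_ops G K (f' \o f).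
Proof.
move=> /bounded_opsP[l' [C' C'0 fC']] /bounded_opsP[l [C C0 fC]].
apply/bounded_opsP; split; first by move=> c x y; rewrite /= l l'.
exists (C' * C); first by rewrite mulr_gt0.
by move=> h /=; apply: le_trans (fC' _) _; rewrite -mulrA ler_pM2l.
Qed.

(** * Projections for real parts of inner products *)

(* The real part of a complete complex inner product on V; working with it
   keeps all orthogonality arguments over the totally ordered field R. *)
Record cform (R : realType) (V : lmodType R[i]) := {
  cf :> V -> V -> R ;
  cfC : forall x y, cf x y = cf y x ;
  cfDr : forall x y z, cf x (y + z) = cf x y + cf x z ;
  cfZr : forall t x y, cf x (t%:C *: y) = t * cf x y ;
  cfi : forall x y, cf ('i *: x) ('i *: y) = cf x y ;
  cf_gt0 : forall x, x != 0 -> 0 < cf x x ;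
  cf_complete : seq_complete (fun x => cf x x) }.

(** Reduces complex scalars to real ones and ['i], the only scalars whose effect on a [cform] is
    prescribed. *)
Lemma scale_complexE (R : realType) (V : lmodType R[i]) (c : R[i]) (x : V) :
  c *: x = (complex.Re c)%:C *: x + (complex.Im c)%:C *: ('i *: x).
Proof. by rewrite scalerA -scalerDl [in LHS](complexE c) [_ * 'i]mulrC. Qed.

Section CForm.
Variables (R : realType) (V : lmodType R[i]) (F : cform V).
Implicit Types (x y v w : V) (t : R) (S : set V).

Lemma cfDl x y z : F (x + y) z = F x z + F y z.
Proof. by rewrite cfC cfDr !(cfC F z). Qed.

Lemma cfZl t x y : F (t%:C *: x) y = t * F x y.
Proof. by rewrite cfC cfZr cfC. Qed.

Lemma cfNr x y : F x (- y) = - F x y.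
Proof.
by rewrite -scaleN1r -[-1 in LHS](rmorphN1 (real_complex R)) cfZr mulN1r.
Qed.

Lemma cfNl x y : F (- x) y = - F x y.
Proof. by rewrite cfC cfNr cfC. Qed.

Lemma cfBr x y z : F x (y - z) = F x y - F x z.
Proof. by rewrite cfDr cfNr. Qed.

Lemma cfBl x y z : F (x - y) z = F x z - F y z.
Proof. by rewrite cfDl cfNl. Qed.

Lemma cf0r x : F x 0 = 0.
Proof. by rewrite -(subrr x) cfBr subrr. Qed.

Lemma cf0l x : F 0 x = 0.
Proof. by rewrite cfC cf0r. Qed.

Lemma cfii x y : F ('i *: x) y = - F x ('i *: y).
Proof. by rewrite -[in RHS]cfi scalerA -expr2 sqr_i scaleN1r cfNr opprK. Qed.

Lemma cf_ge0 x : 0 <= F x x.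
Proof. by have [->|/cf_gt0/ltW//] := eqVneq x 0; rewrite cf0r. Qed.

Lemma cf_eq0 x : F x x = 0 -> x = 0.
Proof. by move=> xx; apply/eqP/negP => /negP/(cf_gt0 F); rewrite xx ltxx. Qed.

Lemma cf_ext x y : (forall z, F z x = F z y) -> x = y.
Proof.
by move=> xy; apply/subr0_eq/cf_eq0; rewrite cfBr xy subrr.
Qed.

(** For nonzero [y], expand the form at the component of [x] orthogonal to [y]. *)
Lemma cf_CS x y : F x y ^+ 2 <= F x x * F y y.
Proof.
have [->|/(cf_gt0 F) y0] := eqVneq y 0; first by rewrite !cf0r expr0n mulr0.
have := cf_ge0 (x - (F x y / F y y)%:C *: y).
rewrite cfBr !cfBl !cfZr !cfZl (cfC F y x) => h.
rewrite -ler_pdivrMr//.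
suff <- : F x y / F y y * F x y = F x y ^+ 2 / F y y.
  by move: h; rewrite divfK ?gt_eqF// subrr subr0 subr_ge0.
by rewrite expr2 mulrAC.
Qed.

Lemma cfB2 x y : F (x - y) (x - y) <= 2 * F x x + 2 * F y y.
Proof.
have := cf_ge0 (x + y); rewrite cfBr !cfBl cfDr !cfDl (cfC F y x); lra.
Qed.

(** Closeness is measured by squared distances, so no square root of the form is needed. *)
Definition cl S v :=
  forall e : R, 0 < e -> exists2 s, S s & F (v - s) (v - s) < e.

Definition orth S w := forall s, S s -> F s w = 0.

Lemma cl_sub S : S `<=` cl S.
Proof. by move=> s Ss e e0; exists s => //; rewrite subrr cf0r. Qed.

Lemma cl_orth S k w : cl S k -> orth S w -> F k w = 0.
Proof.
move=> kS oS; apply/eqP; rewrite -sqrf_eq0 eq_le sqr_ge0 andbT.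
apply/ler_addgt0Pl => e e0; rewrite addr0.
(* The summand 1 keeps the denominator positive when [w] is zero. *)
have d0 : 0 < e / (F w w + 1) by rewrite divr_gt0// ltr_wpDl// cf_ge0.
have [s /oS sw ks] := kS _ d0.
have -> : F k w = F (k - s) w by rewrite cfBl sw subr0.
apply: le_trans (cf_CS _ _) _.
apply: le_trans (_ : e / (F w w + 1) * (F w w + 1) <= _); last first.
  by rewrite divfK// gt_eqF// ltr_wpDl// cf_ge0.
by rewrite ler_pM ?cf_ge0 ?(ltW ks)// lerDl.
Qed.

(** Projections are built over real scalars alone; stability under ['i] enters only when complex
    linearity is wanted. *)
Definition real_subspace S :=
  S 0 /\ forall t x y, S x -> S y -> S (t%:C *: x + y).

Section Projection.
Variable S : set V.
Hypothesis hS : real_subspace S.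

Let SZ t s : S s -> S (t%:C *: s).
Proof. by move=> Ss; rewrite -[_ *: _]addr0; exact: hS.2 Ss hS.1. Qed.

Let SD s s' : S s -> S s' -> S (s + s').
Proof. by move=> Ss Ss'; rewrite -[s]scale1r; exact: (hS.2 1). Qed.

(* A minimizing sequence in S for the distance to v is Cauchy by the
   parallelogram identity. *)
Theorem oproj_ex v : exists k, cl S k /\ orth S (v - k).
Proof.
pose D := [set F (v - s) (v - s) | s in S].
have D0 : has_inf D.
  split; first by exists (F (v - 0) (v - 0)); exists 0 => //; exact: hS.1.
  by exists 0 => _ [s _ <-]; exact: cf_ge0.
have lbD s : S s -> inf D <= F (v - s) (v - s).
  by move=> Ss; apply: (ge_inf D0.2); exists s.
have /choice[s sP] : forall n : nat, exists s, S s /\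
    F (v - s) (v - s) < inf D + n.+1%:R^-1.
  move=> n; have n0 : 0 < n.+1%:R^-1 :> R by rewrite invr_gt0.
  by have [_ [s Ss <-] sv] := inf_adherent n0 D0; exists s.
have sS n : S (s n) by case: (sP n).
have sC m n : F (s m - s n) (s m - s n) <= 2 * m.+1%:R^-1 + 2 * n.+1%:R^-1.
  (* The midpoint is again in [S], hence no closer to [v] than the infimum; this is what the
     parallelogram identity needs. *)
  have /lbD : S (2^-1%:C *: (s m + s n)) by apply/SZ/SD.
  set h := 2^-1%:C *: _.
  have hE x : F x h = 2^-1 * (F x (s m) + F x (s n)) by rewrite cfZr cfDr.
  have hE' x : F h x = 2^-1 * (F (s m) x + F (s n) x) by rewrite cfZl cfDl.
  have := (sP m).2; have := (sP n).2.
  rewrite !(cfBr, cfBl, hE, hE') !(cfC F v) (cfC F (s m) (s n)).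
  by move: (m.+1%:R^-1) (n.+1%:R^-1) => a b; lra.
have [e e0|k kP] := @cf_complete _ _ F s.
  have [n0 n0P] := invn_lt (divr_gt0 e0 (ltr0n _ 4)).
  exists n0 => m n /n0P hm /n0P hn; apply: le_lt_trans (sC _ _) _.
  move: hm hn; move: (m.+1%:R^-1) (n.+1%:R^-1) => a b; lra.
exists k; split.
  move=> e /kP[n0 /(_ n0 (leqnn _))] h; exists (s n0) => //.
  by rewrite -opprB cfNr cfNl opprK.
move=> x Sx; have [->|/(cf_gt0 F) x0] := eqVneq x 0; first by rewrite cf0l.
(* Moving [s n] by the optimal multiple [t] of [x] lowers the squared distance by
   [F x w ^+ 2 / F x x], and at most [n.+1%:R^-1] is available above the infimum. *)
have xs n : F x (v - s n) ^+ 2 <= F x x * n.+1%:R^-1.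
  set w := v - s n; pose t := F x w / F x x.
  have /lbD : S (t%:C *: x + s n) by exact: hS.2.
  rewrite opprD addrCA -/w addrC => h.
  have := (sP n).2; rewrite -/w => h'.
  clearbody w.
  have : F w w <= F (w - t%:C *: x) (w - t%:C *: x) + n.+1%:R^-1.
    by apply: le_trans (ltW h') _; rewrite lerD2r.
  rewrite cfBr !cfBl !(cfZr, cfZl) (cfC F w x) [t * F x x]divfK ?gt_eqF// => h2.
  rewrite mulrC -ler_pdivrMr// expr2 -mulrA -/t.
  have -> : F x w * (F x w / F x x) = t * F x w by rewrite mulrC.
  by move: h2; move: (n.+1%:R^-1) => a; lra.
apply/eqP; rewrite -sqrf_eq0 eq_le sqr_ge0 andbT.
apply/ler_addgt0Pl => e e0; rewrite addr0.
(* With this choice each of the two terms below has square at most [e / 4], so their sum has square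
   at most [e]. *)
have d0 : 0 < e / (4 * F x x) by rewrite divr_gt0// mulr_gt0.
have [n1 /(_ (maxn n1 _) (leq_maxl _ _)) n1P] := kP _ d0.
have [n2 /(_ (maxn n1 n2) (leq_maxr _ _)) n2P] := invn_lt d0.
move: (maxn n1 n2) (n1P n2) n2P => n {}n1P n2P.
have -> : F x (v - k) = F x (v - s n) + F x (s n - k) by rewrite -cfDr subrKA.
have h1 := le_trans (xs n) (ler_wpM2l (ltW x0) (ltW n2P)).
have h2 := le_trans (cf_CS x (s n - k)) (ler_wpM2l (ltW x0) (ltW n1P)).
have E : F x x * (e / (4 * F x x)) = e / 4.
  by rewrite invfM mulrCA; congr (_ * _); rewrite mulrCA divff ?mulr1// gt_eqF.
rewrite E in h1 h2; nra.
Qed.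

Definition oproj v := projT1 (cid (oproj_ex v)).

Lemma oproj_cl v : cl S (oproj v).
Proof. by rewrite /oproj; case: cid => k []. Qed.

Lemma oproj_orth v : orth S (v - oproj v).
Proof. by rewrite /oproj; case: cid => k []. Qed.

Lemma clB k k' : cl S k -> cl S k' -> cl S (k - k').
Proof.
move=> kS kS' e e0.
have [|s Ss ks] := kS (e / 4); first by rewrite divr_gt0.
have [|s' Ss' ks'] := kS' (e / 4); first by rewrite divr_gt0.
exists (s - s').
  by rewrite addrC -scaleN1r -[-1](rmorphN1 (real_complex R)); exact: hS.2.
have -> : k - k' - (s - s') = (k - s) - (k' - s').
  by rewrite !opprB addrACA [in RHS]addrACA [- k' + _]addrC.
by apply: le_lt_trans (cfB2 _ _) _; lra.
Qed.

(** The difference of two candidates lies in the closure of [S] and is orthogonal to [S], hence to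
    itself. *)
Lemma oproj_unique v k : cl S k -> orth S (v - k) -> oproj v = k.
Proof.
move=> kS ko; apply/subr0_eq/cf_eq0.
apply: (cl_orth (clB (oproj_cl v) kS)) => s Ss.
have -> : oproj v - k = (v - k) - (v - oproj v).
  by rewrite opprB [in RHS]addrC subrKA.
by rewrite cfBr ko// oproj_orth// subrr.
Qed.

Lemma oprojD v w : oproj (v + w) = oproj v + oproj w.
Proof.
apply: oproj_unique.
  rewrite -[oproj w]opprK; apply: clB; first exact: oproj_cl.
  rewrite -[- _]add0r; apply: clB; last exact: oproj_cl.
  exact/cl_sub/hS.1.
by move=> s Ss; rewrite opprD addrACA cfDr !oproj_orth// addr0.
Qed.

Lemma oproj_contract v : F (oproj v) (oproj v) <= F v v.
Proof.
have := cf_ge0 (v - oproj v).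
have := cl_orth (oproj_cl v) (@oproj_orth v).
rewrite !(cfBr, cfBl) (cfC F v (oproj v)); lra.
Qed.

End Projection.
End CForm.

Section ProjectionCommute.
Variables (R : realType) (V W : lmodType R[i]) (F : cform V) (F' : cform W).
Variables (S : set V) (S' : set W).
Hypotheses (hS : real_subspace S) (hS' : real_subspace S').

(** [T] is continuous, so it carries the closure of [S] into that of [S']; the image of the
    decomposition of [v] is therefore the decomposition of [T v]. *)
Lemma oproj_commute (T : V -> W) (M : R) v :
  {morph T : x y / x - y} ->
  (forall x, F' (T x) (T x) <= M * F x x) ->
  (forall s, S s -> S' (T s)) ->
  (forall w, orth F S w -> orth F' S' (T w)) ->
  T (oproj F hS v) = oproj F' hS' (T v).
Proof.
move=> TB TM TS To; symmetry; apply: oproj_unique.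
  move=> e e0.
  have [|s Ss sv] := oproj_cl F hS v (e := e / (`|M| + 1)).
    by rewrite divr_gt0// ltr_wpDl.
  exists (T s); first exact: TS.
  rewrite -TB; apply: le_lt_trans (TM _) _.
  apply: (@le_lt_trans _ _
    ((`|M| + 1) * F (oproj F hS v - s) (oproj F hS v - s))).
    by rewrite ler_wpM2r ?cf_ge0// (le_trans (ler_norm _))// lerDl.
  by rewrite mulrC -ltr_pdivlMr// ltr_wpDl.
by rewrite -TB; apply: To; exact: oproj_orth.
Qed.

End ProjectionCommute.

(** * Riesz representation and adjoints of bounded operators *)

Section Riesz.
Variables (R : realType) (V : lmodType R[i]) (F : cform V).

Lemma riesz (f : V -> R) (M : R) :
  {morph f : x y / x + y} -> (forall t x, f (t%:C *: x) = t * f x) ->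
  (forall x, f x ^+ 2 <= M * F x x) -> exists y, forall x, f x = F y x.
Proof.
move=> fD fZ fM; have [f0|] := pselect (forall x, f x = 0).
  by exists 0 => x; rewrite f0 cf0l.
move=> /existsNP[v /eqP fv0].
have hS : real_subspace [set x | f x = 0].
  split=> [|t x y /= fx fy]; last by rewrite fD fZ fx fy mulr0 addr0.
  by have := fZ 0 0; rewrite mul0r scaler0.
set p := oproj F hS v; set w := v - p.
have fN x : f (- x) = - f x.
  by rewrite -scaleN1r -[-1 in LHS](rmorphN1 (real_complex R)) fZ mulN1r.
(* The bound on [f] makes its kernel closed, and [p] lies in the closure of the kernel. *)
have fp : f p = 0.
  apply/eqP; rewrite -sqrf_eq0 eq_le sqr_ge0 andbT.
  apply/ler_addgt0Pl => e e0; rewrite addr0.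
  have d0 : 0 < e / (`|M| + 1) by rewrite divr_gt0// ltr_wpDl.
  have [s fs ps] := oproj_cl F hS v d0.
  have -> : f p = f (p - s) by rewrite fD fN fs subr0.
  apply: le_trans (fM _) _.
  apply: le_trans (_ : (`|M| + 1) * F (p - s) (p - s) <= _).
    by rewrite ler_wpM2r ?cf_ge0// (le_trans (ler_norm _))// lerDl.
  by rewrite mulrC -ler_pdivlMr ?(ltW ps)// ltr_wpDl.
have fw : f w = f v by rewrite fD fN fp subr0.
have wo x : f x = 0 -> F x w = 0 by exact: oproj_orth.
clearbody w; have w0 : 0 < F w w.
  apply: cf_gt0; apply/eqP => w0; move: fv0; rewrite -fw w0.
  by have := fZ 0 0; rewrite mul0r scaler0 => ->; rewrite eqxx.
(* The scalar is forced by testing at [w], where [f w = f v]; every [x] is a multiple of [w] plus a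
   vector of the kernel. *)
exists ((f v / F w w)%:C *: w) => x; rewrite cfZl.
have /wo : f (x - (f x / f v)%:C *: w) = 0.
  by rewrite fD fN fZ fw divfK// subrr.
move/eqP; rewrite cfBl cfZl subr_eq0 (cfC F x) => /eqP ->.
by field; rewrite fv0 gt_eqF.
Qed.

End Riesz.

Section HilbertForm.
Variables (R : realType) (H : hilbertType R).
Implicit Types x y : H.

Definition rinner x y : R := complex.Re (inner x y).

Lemma innerC x y : inner x y = (inner y x)^*.
Proof. by rewrite /inner hermC expr0 mul1r. Qed.

Lemma innerDr x y z : inner x (y + z) = inner x y + inner x z.
Proof. by rewrite /inner linearDl. Qed.

Lemma innerDl x y z : inner (x + y) z = inner x z + inner y z.
Proof. by rewrite /inner linearDr. Qed.

Lemma inner0r x : inner x 0 = 0.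
Proof. by rewrite /inner linear0l. Qed.

Lemma inner0l x : inner 0 x = 0.
Proof. by rewrite /inner linear0r. Qed.

Lemma innerBr x y z : inner x (y - z) = inner x y - inner x z.
Proof. by rewrite /inner linearBl. Qed.

Lemma innerZr c x y : inner x (c *: y) = c * inner x y.
Proof. by rewrite /inner linearZl_LR. Qed.

Lemma innerZl c x y : inner (c *: x) y = c^* * inner x y.
Proof. by rewrite /inner linearZr_LR. Qed.

Lemma rinnerE x : rinner x x = rnorm x ^+ 2.
Proof. by rewrite /rinner /inner hdot_norm rnormE -rmorphXn. Qed.

Let rinnerC x y : rinner x y = rinner y x.
Proof. by rewrite /rinner innerC; case: (inner y x). Qed.

Let rinnerDr x y z : rinner x (y + z) = rinner x y + rinner x z.
Proof. by rewrite /rinner innerDr raddfD. Qed.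

Let rinnerZr t x y : rinner x (t%:C *: y) = t * rinner x y.
Proof.
by rewrite /rinner innerZr; case: (inner x y) => a b /=; rewrite mul0r subr0.
Qed.

Let rinneri x y : rinner ('i *: x) ('i *: y) = rinner x y.
Proof.
rewrite /rinner innerZr innerZl; case: (inner x y) => a b /=.
by simpc; rewrite ?opprK; ring.
Qed.

Let rinner_gt0 x : x != 0 -> 0 < rinner x x.
Proof.
by move=> x0; rewrite rinnerE exprn_gt0// rnorm_gt0.
Qed.

Let rinner_complete : seq_complete (fun x => rinner x x).
Proof.
move=> u uC.
have sqrtP x e : 0 < e -> (rinner x x < e ^+ 2) = (rnorm x < e).
  by move=> e0; rewrite rinnerE ltr_pXn2r// ?nnegrE ?rnorm_ge0// ltW.
have [e e0|l ul] := @rnorm_complete _ H u.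
  have [n0 n0P] := uC _ (exprn_gt0 2 e0); exists n0 => m n hm hn.
  by rewrite -sqrtP//; exact: n0P.
exists l => e e0; have s0 : 0 < Num.sqrt e by rewrite sqrtr_gt0.
have [n0 n0P] := ul _ s0; exists n0 => n /n0P.
by rewrite -sqrtP// sqr_sqrtr// ltW.
Qed.

Definition hform : cform H := Build_cform rinnerC rinnerDr rinnerZr rinneri
  rinner_gt0 rinner_complete.

Lemma hform_norm x : hform x x = rnorm x ^+ 2.
Proof. exact: rinnerE. Qed.

(** The real form determines the complex inner product, so adjoint relations can be checked on real
    parts. *)
Lemma innerE x y : inner x y = hform x y -i* hform x ('i *: y).
Proof.
rewrite /= /rinner innerZr; case: (inner x y) => a b /=.
by rewrite mul0r mul1r sub0r opprK.
Qed.

Lemma hform_CS x y : `|hform x y| <= rnorm x * rnorm y.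
Proof.
rewrite -(@ler_pXn2r _ 2)// ?nnegrE ?mulr_ge0 ?rnorm_ge0//.
by rewrite real_normK ?num_real// exprMn -!hform_norm cf_CS.
Qed.

Lemma rnorm_le_hform x (M : R) : 0 <= M ->
  (forall y, hform x y <= M * rnorm y) -> rnorm x <= M.
Proof.
move=> M0 xM; have [->|x0] := eqVneq x 0; first by rewrite rnorm0.
by have := xM x; rewrite hform_norm expr2 ler_pM2r// rnorm_gt0.
Qed.

End HilbertForm.

Section Linear.
Variables (R : realType) (V W : lmodType R[i]) (f : V -> W).
Hypothesis lf : linear f.

Lemma linear_additive : {morph f : x y / x + y}.
Proof. by move=> x y; rewrite -[x]scale1r lf !scale1r. Qed.

Lemma linear_zero : f 0 = 0.
Proof. by apply: (@addrI _ (f 0)); rewrite -linear_additive !addr0. Qed.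

Lemma linear_scale c x : f (c *: x) = c *: f x.
Proof. by have := lf c x 0; rewrite linear_zero !addr0. Qed.

Lemma linear_sub : {morph f : x y / x - y}.
Proof.
by move=> x y; rewrite linear_additive -scaleN1r linear_scale scaleN1r.
Qed.

Lemma linear_bigsum n (x : 'I_n -> V) : f (\sum_i x i) = \sum_i f (x i).
Proof. by apply: (big_morph f linear_additive linear_zero). Qed.

End Linear.

Section Adjoint.
Variables (R : realType) (G H : hilbertType R).
Implicit Types (f : G -> H).

Lemma adjoint_opsP f (f' : H -> G) :
  linear f -> (forall g h, hform H h (f g) = hform G (f' h) g) ->
  adjoint_ops f f'.
Proof. by move=> lf ff g h; rewrite !innerE ff -(linear_scale lf) ff. Qed.

Lemma adjoint_opsE f (f' : H -> G) g h :
  adjoint_ops f f' -> hform H h (f g) = hform G (f' h) g.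
Proof. by move=> ff; rewrite /= /rinner ff. Qed.

(** For fixed [h], the Riesz lemma is applied to the real functional that pairs [h] with [f g];
    Cauchy-Schwarz bounds it by [rnorm h * M]. *)
Lemma adjoint_ops_ex f : bounded_ops G H f ->
  exists2 f', bounded_ops H G f' & adjoint_ops f f'.
Proof.
move=> /bounded_opsP[lf [M M0 fM]].
have /choice[f' ff] : forall h, exists y, forall g,
    hform H h (f g) = hform G y g.
  move=> h; apply: (@riesz _ _ (hform G) _ ((rnorm h * M) ^+ 2)).
  - by move=> x y; rewrite linear_additive// cfDr.
  - by move=> t x; rewrite linear_scale// cfZr.
  - move=> x; rewrite hform_norm -exprMn -[leLHS]real_normK ?num_real//.
    rewrite ler_pXn2r ?nnegrE ?mulr_ge0 ?rnorm_ge0 ?(ltW M0)//.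
    apply: le_trans (hform_CS _ _) _.
    by rewrite -mulrA ler_wpM2l ?rnorm_ge0.
exists f'; last exact: adjoint_opsP.
apply/bounded_opsP; split; last first.
  exists M => // h; apply: rnorm_le_hform.
    by rewrite mulr_ge0 ?rnorm_ge0// ltW.
  move=> g; rewrite -ff (le_trans (ler_norm _))// (le_trans (hform_CS _ _))//.
  by rewrite (mulrC M) -mulrA ler_wpM2l ?rnorm_ge0.
(* Linearity is tested against all [z]: real scalars pass through the form, and ['i] is moved across
   it with a change of sign. *)
move=> c x y; apply: (@cf_ext _ _ (hform G)) => z.
rewrite (cfC _ z) -ff (scale_complexE c x) (scale_complexE c (f' x)).
rewrite !(cfDr, cfDl, cfZr, cfZl) cfii -(linear_scale lf) !ff.
by rewrite !(cfC _ z) cfii.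
Qed.

End Adjoint.

(** * Finite direct sums of spaces with a form *)

Section PiForm.
Variables (R : realType) (V : lmodType R[i]) (F : cform V) (n : nat).
Implicit Types x y : 'I_n -> V.

Definition pisum x y : R := \sum_i F (x i) (y i).

Let pisumC x y : pisum x y = pisum y x.
Proof. by apply: eq_bigr => i _; rewrite cfC. Qed.

Let pisumDr x y z : pisum x (y + z) = pisum x y + pisum x z.
Proof. by rewrite -big_split; apply: eq_bigr => i _; rewrite /= cfDr. Qed.

Let pisumZr t x y : pisum x (t%:C *: y) = t * pisum x y.
Proof. by rewrite mulr_sumr; apply: eq_bigr => i _; rewrite /= cfZr. Qed.

Let pisumi x y : pisum ('i *: x) ('i *: y) = pisum x y.
Proof. by apply: eq_bigr => i _; rewrite /= cfi. Qed.

Let pisum_gt0 x : x != 0 -> 0 < pisum x x.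
Proof.
move=> x0; rewrite lt0r sumr_ge0 ?andbT; last by move=> *; exact: cf_ge0.
apply: contra x0; rewrite psumr_eq0; last by move=> *; exact: cf_ge0.
move=> /allP x0; apply/eqP/funext => i.
by have /x0/eqP/cf_eq0 : i \in index_enum 'I_n by rewrite mem_index_enum.
Qed.

Let pisum_complete : seq_complete (fun x => pisum x x).
Proof.
move=> u uC.
have /choice[l ul] : forall i, exists l, forall e, 0 < e -> exists n0,
    forall k, (n0 <= k)%N -> F (u k i - l) (u k i - l) < e.
  move=> i; apply: (@cf_complete _ _ F (fun k => u k i)) => e e0.
  have [n0 n0P] := uC _ e0; exists n0 => m k hm hk.
  apply: le_lt_trans (n0P _ _ hm hk); rewrite /pisum (bigD1 i)//= lerDl.
  by rewrite sumr_ge0// => *; exact: cf_ge0.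
(* Dividing by [n.+1] instead of [n] allows [n = 0] and keeps the sum of the [n] errors strictly
   below [e]. *)
exists l => e e0; have d0 : 0 < e / n.+1%:R by rewrite divr_gt0.
have /choice[N NP] : forall i, exists n0,
    forall k, (n0 <= k)%N -> F (u k i - l i) (u k i - l i) < e / n.+1%:R.
  by move=> i; exact: ul.
exists (\max_i N i)%N => k hk.
apply: (@le_lt_trans _ _ (\sum_(i < n) (e / n.+1%:R))).
  by apply: ler_sum => i _; apply/ltW/NP/(leq_trans _ hk)/leq_bigmax.
rewrite sumr_const card_ord -[_ *+ n]mulr_natr -mulrA gtr_pMr// mulrC.
by rewrite ltr_pdivrMr// mul1r ltr_nat.
Qed.

Definition piform : cform ('I_n -> V) := Build_cform pisumC pisumDr pisumZr
  pisumi pisum_gt0 pisum_complete.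

End PiForm.

(** * Bounded operators prescribed on a total family *)

(* Iterating the hypothesis gives a ^+ 2 ^ n <= K / q 0 for a = q 1 / (C q 0),
   which forces a <= 1. *)
Lemma spectral_bound (R : realType) (q : nat -> R) (C K : R) : 0 < C ->
  (forall k, 0 <= q k) -> (forall k, q k ^+ 2 <= q 0%N * q k.*2) ->
  (forall k, q k <= K * C ^+ k) -> q 1%N <= C * q 0%N.
Proof.
move=> C0 q0 qq qC; have := q0 0%N; rewrite le_eqVlt => /predU1P[q00|q00].
  have := qq 1%N; rewrite -q00 mul0r mulr0 => q1.
  have : q 1%N ^+ 2 == 0 by rewrite eq_le q1 sqr_ge0.
  by rewrite sqrf_eq0 => /eqP ->.
rewrite -ler_pdivrMr// leNgt; apply/negP => a1.
set a := q 1%N / q 0%N / C.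
have a1' : 1 < a by rewrite ltr_pdivlMr// mul1r.
(* The induction step squares the bound and applies the doubling hypothesis at [2 ^ n]. *)
have aq n : a ^+ (2 ^ n) <= q (2 ^ n)%N / q 0%N / C ^+ (2 ^ n).
  elim: n => [|n IH]; first by rewrite expn0 !expr1.
  have a0 : 0 <= a by rewrite ltW// (lt_trans ltr01).
  rewrite expnS mulnC exprM.
  apply: (@le_trans _ _ ((q (2 ^ n)%N / q 0%N / C ^+ (2 ^ n)) ^+ 2)).
    by rewrite ler_pXn2r// nnegrE ?exprn_ge0// !divr_ge0// ?exprn_ge0// ltW.
  rewrite !expr_div_n -exprM ler_pM2r ?invr_gt0 ?exprn_gt0//.
  rewrite ler_pdivrMr ?exprn_gt0// muln2 mulrAC -mulrA expr2 mulfK ?gt_eqF//.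
  by rewrite [leRHS]mulrC -expr2 qq.
have aK n : a ^+ (2 ^ n) <= K / q 0%N.
  apply: le_trans (aq n) _; rewrite mulrAC ler_pM2r ?invr_gt0//.
  by rewrite ler_pdivrMr ?exprn_gt0.
(* Bernoulli's inequality: the powers of [a] grow at least linearly, against the fixed bound
   [K / q 0]. *)
have bern n : 1 + n%:R * (a - 1) <= a ^+ n.
  elim: n => [|n IH]; first by rewrite mul0r addr0 expr0.
  rewrite exprS -natr1.
  have n0 : 0 <= n%:R * (a - 1) ^+ 2 by rewrite mulr_ge0// sqr_ge0.
  apply: le_trans (_ : a * (1 + n%:R * (a - 1)) <= _); first by nra.
  by rewrite ler_pM2l// (lt_trans ltr01).
pose n := Num.bound (K / q 0%N / (a - 1)).
have : n%:R * (a - 1) < K / q 0%N.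
  apply: lt_le_trans (aK n); apply: lt_le_trans (_ : 1 + n%:R * (a - 1) <= _).
    by rewrite ltrDr.
  apply: le_trans (bern n) _.
  by rewrite ler_weXn2l ?(ltW a1')// ltnW// ltn_expl.
rewrite -ltr_pdivlMr ?subr_gt0// ltNge => /negP; apply; apply/ltW.
rewrite /n archi_boundP// divr_ge0 ?subr_ge0 ?(ltW a1')//.
by rewrite (le_trans _ (aK 0%N))// exprn_ge0// (le_trans ler01)// ltW.
Qed.

Section LinComb.
Variables (R : realType) (I : Type) (V : lmodType R[i]).
Implicit Types (e : I -> V) (s : seq (R[i] * I)).

(** Coefficients are attached to indices, not vectors, so one formal combination can be evaluated in
    several families. *)
Definition lincomb e s := \sum_(x <- s) x.1 *: e x.2.

Lemma lincomb_linear e c s s' :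
  c *: lincomb e s + lincomb e s' =
  lincomb e ([seq (c * x.1, x.2) | x <- s] ++ s').
Proof.
rewrite /lincomb big_cat big_map scaler_sumr; congr (_ + _).
by apply: eq_bigr => x _; rewrite scalerA.
Qed.

Lemma lincomb1 e p : lincomb e [:: (1, p)] = e p.
Proof. by rewrite /lincomb big_seq1 scale1r. Qed.

End LinComb.

Section Total.
Variables (R : realType) (I : Type) (H : hilbertType R) (e : I -> H).
Implicit Types (s : seq (R[i] * I)).

Lemma lincomb_map (H' : lmodType R[i]) (f : H -> H') s :
  linear f -> f (lincomb e s) = lincomb (f \o e) s.
Proof.
move=> lf; rewrite /lincomb (big_morph f (linear_additive lf) (linear_zero lf)).
by apply: eq_bigr => x _; rewrite linear_scale.
Qed.

Lemma rnorm_lincomb s :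
  rnorm (lincomb e s) <= \sum_(x <- s) complex.Re `|x.1| * rnorm (e x.2).
Proof.
rewrite /lincomb; elim/big_ind2 : _ => [|x a y b xa yb|x _].
- by rewrite rnorm0.
- by apply: le_trans (rnormD _ _) _; rewrite lerD.
- by rewrite /rnorm normrZ normc_def; case: `|e _| => a b; simpc.
Qed.

Hypothesis eT : total_set (range e).

Lemma total_approx h (d : R) : 0 < d -> exists s, rnorm (h - lincomb e s) < d.
Proof.
move=> d0; have [_ [n [c [a [ea ->]]] ha]] := dense_approx h eT d0.
have /choice[p pa] : forall k, exists p, e p = a k.
  by move=> k; have [p _ <-] := ea k; exists p.
exists [seq (c k, p k) | k <- index_enum 'I_n].
rewrite /lincomb big_map; under eq_bigr do rewrite pa.
exact: ha.
Qed.

(** The difference [k] is orthogonal to the span, so its squared norm is its pairing with [k] minus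
    any approximating combination. *)
Lemma total_ext h h' : (forall p, inner (e p) h = inner (e p) h') -> h = h'.
Proof.
move=> hh'; have {}hh' s : hform H (lincomb e s) (h - h') = 0.
  rewrite /= /rinner /lincomb.
  have -> : inner (\sum_(x <- s) x.1 *: e x.2) (h - h') = 0; last by [].
  elim/big_rec: _ => [|x y _ IH]; first by rewrite inner0l.
  by rewrite innerDl IH addr0 innerZl innerBr hh' subrr mulr0.
apply/subr0_eq; move: (h - h') hh' => k hk; apply/rnorm_eq0/eqP.
rewrite eq_le rnorm_ge0 andbT; apply/ler_addgt0Pl => d d0; rewrite addr0.
have [s sk] := total_approx k d0.
have [->|k0] := eqVneq k 0; first by rewrite rnorm0 ltW.
have k0' : 0 < rnorm k by exact: rnorm_gt0.
rewrite -(ler_pM2r k0') -expr2 -hform_norm.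
have -> : hform H k k = hform H (k - lincomb e s) k.
  by rewrite (cfBl (hform H)) hk subr0.
apply: le_trans (ler_norm _) _; apply: le_trans (hform_CS _ _) _.
by rewrite ler_pM2r// ltW.
Qed.

Lemma bounded_ops_ext (H' : hilbertType R) (f f' : H -> H') :
  bounded_ops H H' f -> bounded_ops H H' f' ->
  (forall p, f (e p) = f' (e p)) -> f = f'.
Proof.
move=> /bounded_opsP[lf [M M0 fM]] /bounded_opsP[lf' [M' M'0 fM']] ff'.
apply/funext => h; apply/subr0_eq/rnorm_eq0/eqP.
rewrite eq_le rnorm_ge0 andbT; apply/ler_addgt0Pl => d d0; rewrite addr0.
have [s] := total_approx h (divr_gt0 d0 (addr_gt0 M0 M'0)).
rewrite ltr_pdivlMr ?addr_gt0// => /ltW; apply: le_trans.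
have fs : f (lincomb e s) = f' (lincomb e s).
  rewrite !lincomb_map//; apply: eq_bigr => x _.
  by rewrite /= ff'.
rewrite -[f h](subrK (f (lincomb e s))) {2}fs -addrA -!linear_sub//.
apply: le_trans (rnormD _ _) _; rewrite mulrDr lerD// mulrC//.
by rewrite rnormB.
Qed.

End Total.

Section Extension.
Variables (R : realType) (I : Type) (H H' : hilbertType R).
Variables (e : I -> H) (e' : I -> H') (C : R).
Hypothesis eT : total_set (range e).
Hypothesis C0 : 0 < C.
Hypothesis eC : forall s, rnorm (lincomb e' s) <= C * rnorm (lincomb e s).

(** The closure of the graph of the map from combinations of [e] to the same combinations of [e'];
    the extension is the function with this graph. *)
Let rel h k := forall d : R, 0 < d ->
  exists2 s, rnorm (h - lincomb e s) < d & rnorm (k - lincomb e' s) < d.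

Let lincombB (V : lmodType R[i]) (E : I -> V) s s' :
  lincomb E s - lincomb E s' =
  lincomb E ([seq (-1 * x.1, x.2) | x <- s'] ++ s).
Proof. by rewrite -lincomb_linear scaleN1r addrC. Qed.

Let rel_ex h : exists k, rel h k.
Proof.
have /choice[s sP] : forall n : nat, exists s,
    rnorm (h - lincomb e s) < n.+1%:R^-1.
  by move=> n; apply: total_approx => //; rewrite invr_gt0.
have [d d0|k kP] := @rnorm_complete _ H' (fun n => lincomb e' (s n)).
  have [n0 n0P] := invn_lt (divr_gt0 d0 (mulr_gt0 (ltr0n _ 2) C0)).
  exists n0 => m n /n0P hm /n0P hn; rewrite lincombB.
  apply: le_lt_trans (eC _) _; rewrite -lincombB.
  have := rnorm_trans (lincomb e (s m)) h (lincomb e (s n)).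
  rewrite [rnorm (_ - h)]rnormB => h1.
  have h2 := lt_trans (sP m) hm; have h3 := lt_trans (sP n) hn.
  rewrite mulrC -ltr_pdivlMr//; apply: le_lt_trans h1 _.
  have -> : d / C = d / (2 * C) + d / (2 * C) by field; rewrite gt_eqF.
  exact: ltrD.
exists k => d d0; have [n1 n1P] := invn_lt d0; have [n2 n2P] := kP _ d0.
exists (s (maxn n1 n2)).
  by apply: lt_trans (sP _) _; rewrite n1P// leq_maxl.
by rewrite rnormB n2P// leq_maxr.
Qed.

Let rel_linear c h k h' k' :
  rel h k -> rel h' k' -> rel (c *: h + h') (c *: k + k').
Proof.
move=> hk hk' d d0; pose c' := complex.Re `|c| + 1.
have rZ (V : normedModType R[i]) (x : V) : rnorm (c *: x) <= c' * rnorm x.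
  rewrite /rnorm normrZ normc_def.
  case: `|x| (normr_ge0 x) => a b; simpc => /andP[_ a0].
  rewrite /c' normc_def/=; rewrite ?mulr0 ?subr0 mulrDl mul1r; lra.
have c0 : 0 < c' by rewrite /c' normc_def /= ltr_wpDl// sqrtr_ge0.
have [s hs ks] := hk (d / 2 / c') (divr_gt0 (divr_gt0 d0 (ltr0n _ 2)) c0).
have [s' hs' ks'] := hk' (d / 2) (divr_gt0 d0 (ltr0n _ 2)).
exists ([seq (c * x.1, x.2) | x <- s] ++ s'); rewrite -lincomb_linear.
  rewrite opprD addrACA -scalerBr; apply: le_lt_trans (rnormD _ _) _.
  rewrite (splitr d); apply: ltrD => //; apply: le_lt_trans (rZ _ _) _.
  by rewrite mulrC -ltr_pdivlMr.
rewrite opprD addrACA -scalerBr; apply: le_lt_trans (rnormD _ _) _.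
rewrite (splitr d); apply: ltrD => //; apply: le_lt_trans (rZ _ _) _.
by rewrite mulrC -ltr_pdivlMr.
Qed.

Let rel_le h k : rel h k -> rnorm k <= C * rnorm h.
Proof.
move=> hk; apply/ler_addgt0Pl => d d0.
have [s hs ks] := hk _ (divr_gt0 d0 (addr_gt0 ltr01 C0)).
have h1 : rnorm (lincomb e s) <= d / (1 + C) + rnorm h.
  rewrite -[lincomb e s](subrK h); apply: le_trans (rnormD _ _) _.
  by rewrite lerD2r rnormB ltW.
have h2 : rnorm k <= d / (1 + C) + rnorm (lincomb e' s).
  rewrite -{1}[k](subrK (lincomb e' s)); apply: le_trans (rnormD _ _) _.
  by rewrite lerD2r ltW.
apply: le_trans h2 _; apply: le_trans (lerD (lexx _) (eC s)) _.
apply: le_trans (lerD (lexx _) (ler_wpM2l (ltW C0) h1)) _.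
rewrite [leRHS](_ : _ = d / (1 + C) + C * (d / (1 + C) + rnorm h))//.
by field; rewrite gt_eqF// addr_gt0.
Qed.

Lemma extension_ex : exists2 f, bounded_ops H H' f & forall p, f (e p) = e' p.
Proof.
have /choice[f fP] := rel_ex.
(* The difference of two images of [h] is related to 0, so [rel_le] makes it vanish. *)
have uniq h k k' : rel h k -> rel h k' -> k = k'.
  move=> hk hk'; apply/subr0_eq/rnorm_eq0/eqP.
  rewrite eq_le rnorm_ge0 andbT.
  have := rel_le (rel_linear (-1) hk' hk).
  by rewrite !scaleN1r addNr rnorm0 mulr0 addrC.
exists f.
  apply/bounded_opsP; split; last by exists C => // h; exact: rel_le.
  by move=> c x y; apply: (uniq (c *: x + y)) => //; exact: rel_linear.
move=> p; apply: (uniq (e p)) => // d d0; exists [:: (1, p)];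
  by rewrite lincomb1 subrr rnorm0.
Qed.

End Extension.

Section SpectralExtension.
Variables (R : realType) (I : Type) (H : hilbertType R) (e : I -> H).
Variables (sigma sigma' : I -> I) (C : R).
Hypothesis eT : total_set (range e).
Hypothesis sigma_adj : forall p q,
  inner (e (sigma p)) (e q) = inner (e p) (e (sigma' q)).
Hypothesis C0 : 0 < C.

(** The counterpart on indices of [f^* f]. *)
Let tau := sigma' \o sigma.

Hypothesis tauC : forall p, exists K, forall k,
  rnorm (e (iter k tau p)) <= K * C ^+ k.

Let inner_lincomb (e1 e2 e3 e4 : I -> H) s s' :
  (forall p q, inner (e1 p) (e2 q) = inner (e3 p) (e4 q)) ->
  inner (lincomb e1 s) (lincomb e2 s') = inner (lincomb e3 s) (lincomb e4 s').
Proof.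
move=> ee; rewrite /lincomb.
elim/big_rec2: _ => [|x y z _ IH]; first by rewrite !inner0l.
rewrite !innerDl IH !innerZl; congr (_ * _ + _).
elim/big_rec2: _ => [|x' y' z' _ IH']; first by rewrite !inner0r.
by rewrite !innerDr !innerZr IH' ee.
Qed.

Let tau_adj p q : inner (e (tau p)) (e q) = inner (e p) (e (tau q)).
Proof.
by rewrite /tau/= -sigma_adj innerC -sigma_adj -innerC.
Qed.

Let tau_iter_adj k p q :
  inner (e (iter k tau p)) (e q) = inner (e p) (e (iter k tau q)).
Proof. by elim: k p q => // k IH p q; rewrite iterS tau_adj IH -iterSr. Qed.

(* Applied to q k = ||tau^k u||, which satisfies (q k)^2 <= q 0 q (2k) because
   tau is formally symmetric, [spectral_bound] bounds tau, hence sigma, without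
   square roots of positive operators. *)
Lemma spectral_extension :
  exists2 f, bounded_ops H H f & forall p, f (e p) = e (sigma p).
Proof.
(* The argument bounds the square of the norm by [C] times a square; [C + 1] replaces the root of
   [C], as [C <= (C + 1) ^+ 2]. *)
apply: (@extension_ex _ _ _ _ e (e \o sigma) (C + 1)) => //.
  by rewrite addr_gt0.
move=> s; pose q k := rnorm (lincomb (e \o iter k tau) s).
have /choice[K KP] := tauC.
have qC : q 1%N <= C * q 0%N.
  pose K' := \sum_(x <- s) complex.Re `|x.1| * K x.2.
  apply: (@spectral_bound _ q C K') => //.
  - by move=> k; exact: rnorm_ge0.
  - move=> k; rewrite /q -hform_norm.
    have -> : hform H (lincomb (e \o iter k tau) s)
          (lincomb (e \o iter k tau) s) =
        hform H (lincomb (e \o iter 0 tau) s) (lincomb (e \o iter k.*2 tau) s).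
      rewrite /= /rinner; congr complex.Re; apply: inner_lincomb => p r /=.
      by rewrite tau_iter_adj -iterD addnn.
    exact: le_trans (ler_norm _) (hform_CS _ _).
  - move=> k; apply: le_trans (rnorm_lincomb _ _) _.
    rewrite mulr_suml; apply: ler_sum => x _; rewrite -mulrA ler_wpM2l//.
    by rewrite normc_def/= sqrtr_ge0.
  exact: KP.
have q2 : rnorm (lincomb (e \o sigma) s) ^+ 2 <= q 0%N * q 1%N.
  rewrite -hform_norm.
  have -> : hform H (lincomb (e \o sigma) s) (lincomb (e \o sigma) s)
        = hform H (lincomb (e \o iter 0 tau) s) (lincomb (e \o iter 1 tau) s).
    rewrite /= /rinner; congr complex.Re; apply: inner_lincomb => p r /=.
    by rewrite sigma_adj.
  exact: le_trans (ler_norm _) (hform_CS _ _).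
have -> : lincomb e s = lincomb (e \o iter 0 tau) s by [].
rewrite -(@ler_pXn2r _ 2)// ?nnegrE ?rnorm_ge0//; last first.
  by rewrite mulr_ge0 ?rnorm_ge0// addr_ge0 ?ltW.
apply: le_trans q2 _; rewrite -/(q 0%N) exprMn.
have q0 : 0 <= q 0%N by exact: rnorm_ge0.
apply: le_trans (ler_wpM2l q0 qC) _; rewrite mulrCA -expr2 ler_wpM2r ?sqr_ge0//.
nra.
Qed.

End SpectralExtension.

(** * Hilbert modules *)

Section UniformBoundedness.
Variables (R : realType) (X : completeNormedModType R[i]) (I : Type).
Variable p : I -> X -> R.
Hypothesis pD : forall i x y, p i (x + y) <= p i x + p i y.
Hypothesis pZ : forall i (t : R) x, p i (t%:C *: x) = `|t| * p i x.
Hypothesis p_bounded : forall i, exists M : R, forall x, p i x <= M * rnorm x.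
Hypothesis p_pointwise : forall x, exists K, forall i, p i x <= K.

Let pN i x : p i (- x) = p i x.
Proof.
by rewrite -scaleN1r -[-1 in LHS](rmorphN1 (real_complex R)) pZ normrN1 mul1r.
Qed.

(* Nested balls: on the n-th one some p i exceeds n everywhere. *)
Theorem uniform_boundedness : exists C : R, forall i x, p i x <= C * rnorm x.
Proof.
apply: contrapT => /forallNP unb.
(* If every [p i] were at most [N] on the ball, subadditivity and scaling would give the global
   constant [2 * N / r], against [unb]. *)
have big (x : X) (r N : R) : 0 < r ->
    exists i y, rnorm (y - x) <= r /\ N < p i y.
  move=> r0; apply: contrapT => /forallNP noi; apply: (unb (2 * N / r)) => i z.
  have /forallNP no := noi i.
  have pN' y : rnorm (y - x) <= r -> p i y <= N.
    by move=> yx; rewrite leNgt; apply/negP => Np; exact: (no y).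
  have [->|z0] := eqVneq z 0.
    have := pZ i 0 0; rewrite scaler0 normr0 mul0r => ->.
    by rewrite rnorm0 mulr0.
  have {}z0 : 0 < rnorm z by exact: rnorm_gt0.
  set t := r / rnorm z; have t0 : 0 < t by rewrite divr_gt0.
  have h1 : p i (t%:C *: z + x) <= N.
    by apply: pN'; rewrite addrK rnormZ gtr0_norm// divfK// gt_eqF.
  have h2 : p i x <= N by apply: pN'; rewrite subrr rnorm0 ltW.
  have h3 := pD i (t%:C *: z + x) (- x).
  rewrite addrK pN pZ gtr0_norm// in h3.
  have h4 : t * p i z <= 2 * N by lra.
  rewrite -(ler_pM2l t0); apply: le_trans h4 _.
  by rewrite [leRHS](_ : _ = 2 * N)// /t; field; rewrite !gt_eqF.
have /choice[step stepP] : forall nb : nat * (X * R), exists b' : X * R,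
    0 < nb.2.2 -> [/\ 0 < b'.2, b'.2 <= nb.1.+1%:R^-1 &
      forall z, rnorm (z - b'.1) <= b'.2 ->
        rnorm (z - nb.2.1) <= nb.2.2 /\ exists i, nb.1%:R < p i z].
  (* A ball of nonpositive radius is returned unchanged; nothing is claimed about it. *)
  move=> [n [x r]] /=; have [r0|] := ltP 0 r; last by exists (x, r).
  have r20 : 0 < r / 2 by rewrite divr_gt0.
  have [i [y [yx Np]]] := big x (r / 2) n%:R r20.
  have [M pM] := p_bounded i.
  (* Within [d / 2] of [y], [p i] drops by at most half its excess over [n], so it stays above
     [n]. *)
  pose d := (p i y - n%:R) / (`|M| + 1).
  have M0 : 0 < `|M| + 1 by rewrite ltr_wpDl.
  have d0 : 0 < d / 2 by rewrite !divr_gt0// subr_gt0.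
  exists (y, Num.min (r / 2) (Num.min n.+1%:R^-1 (d / 2))) => _ /=; split.
  - by rewrite !lt_min r20 d0 invr_gt0 ltr0n.
  - by rewrite !ge_min lexx orbT.
  - move=> z; rewrite !le_min => /and3P[zr _ zd]; split.
      apply: le_trans (rnorm_trans z y x) _; lra.
    exists i; have := pD i z (y - z); rewrite subrKC => h.
    have h1 : p i (y - z) <= (`|M| + 1) * (d / 2).
      apply: le_trans (pM _) _.
      apply: le_trans (_ : (`|M| + 1) * rnorm (y - z) <= _).
        by rewrite ler_wpM2r ?rnorm_ge0// (le_trans (ler_norm _))// lerDl.
      by rewrite ler_pM2l// rnormB.
    have E : (`|M| + 1) * (d / 2) = (p i y - n%:R) / 2.
      by rewrite /d; field; rewrite gt_eqF.
    lra.
pose st := fix st n := if n is n'.+1 then step (n', st n') else (0, 1) : X * R.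
have st0 n : 0 < (st n).2.
  elim: n => [|n IH]; first exact: ltr01.
  by have [] := stepP (n, st n) IH.
have stS n := stepP (n, st n) (st0 n).
have st_sub m n z : rnorm (z - (st (m + n)%N).1) <= (st (m + n)%N).2 ->
    rnorm (z - (st m).1) <= (st m).2.
  elim: n z => [|n IH] z; first by rewrite addn0.
  by rewrite addnS => /(let: And3 _ _ h := stS (m + n)%N in h)[/IH].
have st_in m n : (m <= n)%N -> rnorm ((st n).1 - (st m).1) <= (st m).2.
  move=> mn; apply: (st_sub m (n - m)%N).
  by rewrite subnKC// subrr rnorm0 ltW.
have [e e0|l lP] := @rnorm_complete _ X (fun n => (st n).1).
  have [N NP] := invn_lt (divr_gt0 e0 (ltr0n _ 2)).
  have Ne : (st N.+1).2 < e / 2.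
    by have [_ h _] := stS N; apply: le_lt_trans h (NP _ (leqnn _)).
  exists N.+1 => m n /st_in hm /st_in hn.
  have := rnorm_trans (st m).1 (st N.+1).1 (st n).1.
  by rewrite [rnorm ((st N.+1).1 - _)]rnormB; move: hm hn Ne; lra.
have lst n : rnorm (l - (st n).1) <= (st n).2.
  apply/ler_addgt0Pl => e e0; have [n0 n0P] := lP e e0.
  have h1 := n0P _ (leq_maxl n0 n); have h2 := st_in n _ (leq_maxr n0 n).
  apply: le_trans (rnorm_trans l (st (maxn n0 n)).1 _) _.
  by rewrite rnormB lerD// ltW.
have [K lK] := p_pointwise l.
have K0 : 0 <= K.
  have [_ _ /(_ l (lst 1%N))[_ [i /= h]]] := stS 0%N.
  by apply: le_trans (lK i); exact: ltW.
(* The ball of index [n.+1] is the one on which [n] is exceeded, hence the successor; [l] lies in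
   all the balls. *)
have [_ _ /(_ l (lst (Num.bound K).+1))[_ [i /= h]]] := stS (Num.bound K).
have := lt_le_trans h (lK i); rewrite ltNge => /negP; apply.
by rewrite ltW// archi_boundP.
Qed.

End UniformBoundedness.

(** * Operators on the interior tensor product *)

Section HilbertModule.
Variables (R : realType) (G H : hilbertType R) (B : set (G -> G)).
Variables (E : completeNormedModType R[i]) (M : hilbertModule B E).
Variable T : interior_tensor M H.
Hypothesis hB : von_neumann_algebra B.
Implicit Types (x y : E) (g : G) (a : E -> E).
Local Notation "x (.) g" := (odot T x g) (at level 40).
Local Notation etens := (fun p : E * G => odot T p.1 p.2).

Lemma odot_total_range : total_set (range etens).
Proof.
suff -> : range etens = [set odot T x g | x in [set: E] & g in [set: G]].
  exact: odot_total.
apply/seteqP; split=> [_ [[x g] _ <-]|_ [x _ [g _ <-]]].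
  by exists x => //; exists g.
by exists (x, g).
Qed.

Lemma odot_ext h h' :
  (forall x g, inner (x (.) g) h = inner (x (.) g) h') -> h = h'.
Proof. by move=> hh'; apply: (total_ext odot_total_range) => -[]. Qed.

Lemma odot_linearr x : linear (odot T x).
Proof.
move=> c g g'; apply: odot_ext => y k.
rewrite innerDr innerZr !odot_inner.
have /bounded_opsP[lf _] := vna_bounded hB (hm_innerB M y x).
by rewrite lf innerDr innerZr.
Qed.

Lemma odot_linearl g : linear ((odot T)^~ g).
Proof.
move=> c x x'; apply: odot_ext => y k.
rewrite innerDr innerZr !odot_inner (hm_inner_lin M y).
by rewrite innerDr innerZr.
Qed.

Lemma opnorm_ub (f : G -> G) g :
  bounded_ops G G f -> rnorm (f g) <= opnorm f * rnorm g.
Proof.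
move=> /bounded_opsP[lf [C C0 fC]].
have [->|g0] := eqVneq g 0; first by rewrite linear_zero// !rnorm0 mulr0.
have {}g0 : 0 < rnorm g by exact: rnorm_gt0.
rewrite -ler_pdivrMr// mulrC -[(rnorm g)^-1]gtr0_norm ?invr_gt0// -rnormZ.
rewrite -linear_scale//; apply: ub_le_sup; last first.
  exists ((rnorm g)^-1%:C *: g) => //=; rewrite rnormE lerc1 rnormZ.
  by rewrite gtr0_norm ?invr_gt0// mulVf// gt_eqF.
exists C => _ [k /= k1 <-]; apply: le_trans (fC k) _.
by rewrite ler_piMr ?(ltW C0)// -lerc1 -rnormE.
Qed.

Lemma opnorm_le (f : G -> G) (C : R) : 0 <= C ->
  (forall g, rnorm (f g) <= C * rnorm g) -> opnorm f <= C.
Proof.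
move=> C0 fC; apply: ge_sup.
  by exists (rnorm (f 0)), 0; rewrite //= normr0.
move=> _ [k /= k1 <-]; apply: le_trans (fC k) _.
by rewrite ler_piMr// -lerc1 -rnormE.
Qed.

Lemma rnorm_sqr x : rnorm x ^+ 2 = opnorm (hm_inner M x x).
Proof. by apply: complexI; rewrite -(hm_norm M) rnormE rmorphXn. Qed.

Lemma rnorm_odot x g : rnorm (x (.) g) <= rnorm x * rnorm g.
Proof.
rewrite -(@ler_pXn2r _ 2)// ?nnegrE ?mulr_ge0 ?rnorm_ge0//.
rewrite -hform_norm /= /rinner odot_inner -/(rinner _ _).
apply: le_trans (ler_norm _) _; apply: le_trans (hform_CS _ _) _.
rewrite exprMn rnorm_sqr [leRHS]mulrC expr2 -mulrA ler_wpM2l ?rnorm_ge0//.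
by rewrite mulrC; apply: opnorm_ub; exact: vna_bounded (hm_innerB M x x).
Qed.

(** The matrix coefficients of [hm_inner M x y] are inner products of elementary tensors, so
    Cauchy-Schwarz in [H] applies. *)
Lemma rnorm_hm_inner x y g :
  rnorm (hm_inner M x y g) <= rnorm x * rnorm y * rnorm g.
Proof.
apply: rnorm_le_hform => [|k]; first by rewrite !mulr_ge0 ?rnorm_ge0.
rewrite (cfC (hform G)) /= /rinner -(odot_inner T) -/(rinner _ _).
apply: le_trans (ler_norm _) _; apply: le_trans (hform_CS _ _) _.
apply: le_trans (ler_pM _ _ (rnorm_odot x k) (rnorm_odot y g)) _;
  rewrite ?rnorm_ge0//.
by rewrite [leRHS](_ : _ = rnorm x * rnorm k * (rnorm y * rnorm g))//; ring.
Qed.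

Lemma bounded_Lop x : bounded_ops G H (Lop T x).
Proof.
apply/bounded_opsP; split; first exact: odot_linearr.
exists (rnorm x + 1); first by rewrite ltr_wpDl// rnorm_ge0.
move=> g; apply: le_trans (rnorm_odot _ _) _.
by rewrite ler_wpM2r ?rnorm_ge0// lerDl.
Qed.

Lemma hm_inner_swap x y g k :
  inner k (hm_inner M x y g) = inner (hm_inner M y x k) g.
Proof. exact: hm_inner_adj. Qed.

Lemma adjointable_sym a a' :
  (forall x y, hm_inner M x (a y) = hm_inner M (a' x) y) ->
  forall x y, hm_inner M (a x) y = hm_inner M x (a' y).
Proof.
move=> aa x y; apply/funext => g; apply: (@cf_ext _ _ (hform G)) => k.
by rewrite /= /rinner hm_inner_swap aa -hm_inner_swap.
Qed.

Lemma adjointable_bounded a : adjointable M a ->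
  exists2 C : R, 0 < C & forall x, rnorm (a x) <= C * rnorm x.
Proof.
move=> [a' aa].
(* p (x, g) y is also the norm of <a' x, y> g divided by |x| |g|, so it is
   bounded in y for fixed (x, g) and at most |a y| for fixed y (where x or g
   vanishes, it is the junk value 0). *)
pose p (i : E * G) y :=
  rnorm (hm_inner M i.1 (a y) i.2) / (rnorm i.1 * rnorm i.2).
have i0 (i : E * G) : 0 <= (rnorm i.1 * rnorm i.2)^-1.
  by rewrite invr_ge0 mulr_ge0 ?rnorm_ge0.
have hD i : linear (fun y => hm_inner M i.1 (a y) i.2).
  by move=> c y y'; rewrite aa (hm_inner_lin M) !aa.
have pineq (i : E * G) z (K : R) : 0 <= K ->
    rnorm (hm_inner M i.1 z i.2) <= rnorm i.1 * K * rnorm i.2 ->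
    rnorm (hm_inner M i.1 z i.2) / (rnorm i.1 * rnorm i.2) <= K.
  move=> K0; have [->|i1] := eqVneq (rnorm i.1 * rnorm i.2) 0.
    by rewrite invr0 mulr0.
  rewrite ler_pdivrMr; last by rewrite lt0r i1 mulr_ge0 ?rnorm_ge0.
  by rewrite mulrAC mulrC.
have [||||C pC] := @uniform_boundedness _ E _ p.
- move=> i x y.
  by rewrite /p (linear_additive (hD i)) -mulrDl ler_wpM2r// rnormD.
- by move=> i t x; rewrite /p (linear_scale (hD i)) rnormZ mulrA.
- move=> i; exists (rnorm (a' i.1) * rnorm i.2 / (rnorm i.1 * rnorm i.2)) => x.
  rewrite /p mulrAC ler_wpM2r// aa; apply: le_trans (rnorm_hm_inner _ _ _) _.
  by rewrite mulrAC.
- move=> x; exists (rnorm (a x)) => i.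
  by apply: pineq; rewrite ?rnorm_ge0 ?rnorm_hm_inner.
exists (`|C| + 1); first by rewrite ltr_wpDl.
move=> x; have [->|ax0] := eqVneq (a x) 0.
  by rewrite rnorm0 mulr_ge0 ?rnorm_ge0// addr_ge0.
have {}ax0 : 0 < rnorm (a x) by exact: rnorm_gt0.
have Cx : 0 <= (`|C| + 1) * rnorm x by rewrite mulr_ge0 ?rnorm_ge0// addr_ge0.
(* Taking [a x] itself as the first module argument of [p] bounds the operator [<a x, a x>], whose
   norm is the square of that of [a x]; one factor then cancels. *)
rewrite -(ler_pM2r ax0) -expr2 rnorm_sqr; apply: opnorm_le.
  by rewrite mulr_ge0 ?rnorm_ge0.
move=> g; have [->|g0] := eqVneq g 0.
  have /bounded_opsP[lf _] := vna_bounded hB (hm_innerB M (a x) (a x)).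
  by rewrite (linear_zero lf) !rnorm0 mulr0.
have {}g0 : 0 < rnorm g by exact: rnorm_gt0.
have := pC (a x, g) x; rewrite /p/= ler_pdivrMr ?mulr_gt0// => /le_trans; apply.
rewrite -mulrA -[leRHS]mulrA -[leRHS]mulrA ler_wpM2r//.
  by rewrite !mulr_ge0// ?rnorm_ge0.
by rewrite (le_trans (ler_norm _))// lerDl.
Qed.

(** Totality of the elementary tensors gives uniqueness, so the chosen operator is the expected one
    as soon as one exists. *)
Lemma tensor_opP a b' (f : H -> H) : bounded_ops H H f ->
  (forall x g, f (x (.) g) = a x (.) b' g) -> tensor_op T a b' = f.
Proof.
move=> bf fP; have [bt tP] : [set f : H -> H | bounded_ops H H f /\
    forall x g, f (x (.) g) = a x (.) b' g] (tensor_op T a b').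
  by apply: getPex; exists f.
apply: (bounded_ops_ext odot_total_range) => // -[x g] /=.
by rewrite tP fP.
Qed.

(** [B] contains the adjoint [d] of each of its elements [b], and taking adjoints in [b' d = d b']
    gives commutation of the adjoint of [b'] with [b]. *)
Lemma commutant_adj b' : commutant B b' ->
  exists2 c', commutant B c' & adjoint_ops b' c'.
Proof.
move=> [bb' b'B]; have [c' bc' ac'] := adjoint_ops_ex bb'.
exists c' => //; split=> // b Bb; apply/funext => g.
have [d Bd ad] := vna_adj hB Bb.
apply: (@cf_ext _ _ (hform G)) => k /=; rewrite /rinner; congr complex.Re.
rewrite innerC -ac' -innerC ad innerC.
have /(congr1 (fun f => f k)) /= <- := b'B _ Bd.
by rewrite ac' -innerC ad.
Qed.

(** The maps on indices given by [b'] and its adjoint [c'] are formally adjoint because [<x, y>]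
    lies in [B] and commutes with [c']; [D * C] bounds [c' \o b']. *)
Lemma rho'_ex b' : commutant B b' -> exists2 f, bounded_ops H H f &
  forall x g, f (x (.) g) = x (.) b' g.
Proof.
move=> hb'; have [c' hc' ac'] := commutant_adj hb'.
have /bounded_opsP[lb [C C0 bC]] := hb'.1.
have /bounded_opsP[lc [D D0 cD]] := hc'.1.
have [|||f bf fP] := @spectral_extension _ _ _ etens
   (fun p => (p.1, b' p.2)) (fun p => (p.1, c' p.2)) (D * C) odot_total_range.
- move=> [x g] [y k] /=; rewrite !odot_inner.
  have /(congr1 (fun f => f k)) /= <- := hc'.2 _ (hm_innerB M x y).
  by rewrite innerC ac' -innerC.
- by rewrite mulr_gt0.
- move=> [x g]; exists (rnorm x * rnorm g) => k.
  have -> : iter k ((fun p : E * G => (p.1, c' p.2)) \o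
      (fun p => (p.1, b' p.2))) (x, g) = (x, iter k (c' \o b') g)
    by elim: k => //= k ->.
  apply: le_trans (rnorm_odot _ _) _; rewrite -mulrA ler_wpM2l ?rnorm_ge0//.
  elim: k => [|k IH]; first by rewrite mulr1.
  rewrite iterS/= exprS mulrCA -mulrA.
  apply: le_trans (cD _) _; rewrite ler_pM2l//.
  by apply: le_trans (bC _) _; rewrite ler_pM2l.
by exists f => // x g; exact: (fP (x, g)).
Qed.

(** As for [rho'_ex], with the action on the module factor; the constants come from boundedness of
    [a] and of its adjoint. *)
Lemma adjointable_ex a : adjointable M a -> exists2 f, bounded_ops H H f &
  forall x g, f (x (.) g) = a x (.) g.
Proof.
move=> ha; have [a' aa] := ha; have aa' := adjointable_sym aa.
have [C C0 aC] := adjointable_bounded ha.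
have [|D D0 aD] := @adjointable_bounded a'.
  by exists a => x y; rewrite aa'.
have [|||f bf fP] := @spectral_extension _ _ _ etens
   (fun p => (a p.1, p.2)) (fun p => (a' p.1, p.2)) (D * C) odot_total_range.
- by move=> [x g] [y k] /=; rewrite !odot_inner aa'.
- by rewrite mulr_gt0.
- move=> [x g]; exists (rnorm x * rnorm g) => k.
  have -> : iter k ((fun p : E * G => (a' p.1, p.2)) \o
      (fun p => (a p.1, p.2))) (x, g) = (iter k (a' \o a) x, g)
    by elim: k => //= k ->.
  apply: le_trans (rnorm_odot _ _) _; rewrite mulrAC ler_wpM2r ?rnorm_ge0//.
  elim: k => [|k IH]; first by rewrite mulr1.
  rewrite iterS/= exprS mulrCA -mulrA.
  apply: le_trans (aD _) _; rewrite ler_pM2l//.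
  by apply: le_trans (aC _) _; rewrite ler_pM2l.
by exists f => // x g; exact: (fP (x, g)).
Qed.

Lemma rho'_bounded b' : commutant B b' -> bounded_ops H H (rho' T b').
Proof. by move=> /rho'_ex[f bf fP]; rewrite /rho' (tensor_opP bf). Qed.

Lemma rho'_odot b' x g : commutant B b' -> rho' T b' (x (.) g) = x (.) b' g.
Proof. by move=> /rho'_ex[f bf fP]; rewrite /rho' (tensor_opP bf)// fP. Qed.

Lemma E_ops_intertwiners : E_ops T `<=` intertwiners T.
Proof.
move=> _ [x _ <-]; split; first exact: bounded_Lop.
by move=> b' hb'; apply/funext => g; rewrite /= rho'_odot.
Qed.

Lemma Ba_ops_commutant :
  Ba_ops T `<=` commutant [set rho' T b' | b' in commutant B].
Proof.
move=> _ [a ha <-]; have [f bf fP] := adjointable_ex ha.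
rewrite (tensor_opP (b' := id) bf)//; split=> // _ [b' hb' <-].
have br := rho'_bounded hb'.
apply: (bounded_ops_ext odot_total_range).
- exact: bounded_ops_comp.
- exact: bounded_ops_comp.
- by move=> [x g] /=; rewrite !(rho'_odot, fP).
Qed.

End HilbertModule.

(** * Amplification and density *)

Section ProjectionLinear.
Variables (R : realType) (V : lmodType R[i]) (F : cform V) (S : set V).
Hypothesis hS : real_subspace S.
Hypothesis Si : forall s, S s -> S ('i *: s).

(** Multiplication by a real scalar or by ['i] preserves [S] and its orthogonal complement, so
    [oproj_commute] applies to both. *)
Lemma oproj_linear : linear (oproj F hS).
Proof.
move=> c v w; rewrite oprojD; congr (_ + _).
have pZ t u : oproj F hS (t%:C *: u) = t%:C *: oproj F hS u.
  symmetry; apply: (@oproj_commute _ _ _ F F S S hS hS _ (t ^+ 2)).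
  - by move=> x y; rewrite scalerBr.
  - by move=> x; rewrite cfZr cfZl mulrA expr2.
  - by move=> s Ss; rewrite -[_ *: _]addr0; exact: hS.2 Ss hS.1.
  - by move=> x xo s Ss; rewrite cfZr xo// mulr0.
have pi u : oproj F hS ('i *: u) = 'i *: oproj F hS u.
  symmetry; apply: (@oproj_commute _ _ _ F F S S hS hS _ 1) => //.
  - by move=> x y; rewrite scalerBr.
  - by move=> x; rewrite cfi mul1r.
  - by move=> x xo s Ss; rewrite -[LHS]opprK -cfii xo ?oppr0//; exact: Si.
by rewrite [in LHS]scale_complexE oprojD !pZ pi -scale_complexE.
Qed.

End ProjectionLinear.

Section Entries.
Variables (R : realType) (H : hilbertType R) (n : nat) (S : set ('I_n -> H)).
Hypothesis hS : real_subspace S.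
Hypothesis Si : forall s, S s -> S ('i *: s).
Let F := piform (hform H) n.

Definition single (j : 'I_n) (h : H) : 'I_n -> H :=
  fun i => if i == j then h else 0.

Definition entry (i j : 'I_n) (h : H) : H := oproj F hS (single j h) i.

Lemma rnorm_coord (v : 'I_n -> H) i : rnorm (v i) ^+ 2 <= F v v.
Proof.
rewrite -hform_norm /F /= /pisum (bigD1 i)//= lerDl sumr_ge0// => j _.
exact: (cf_ge0 (hform H)).
Qed.

(** Inclusion of a coordinate, projection and evaluation at a coordinate are contractions, whence
    the bound 1. *)
Lemma entry_bounded i j : bounded_ops H H (entry i j).
Proof.
apply/bounded_opsP; split.
  move=> c h h'; rewrite /entry.
  have -> : single j (c *: h + h') = c *: single j h + single j h'.
    apply/funext => k; rewrite /single !fctE.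
    by case: ifP; rewrite ?scaler0 ?addr0.
  by rewrite (oproj_linear F hS Si).
exists 1 => // h; rewrite mul1r -(@ler_pXn2r _ 2)// ?nnegrE ?rnorm_ge0//.
apply: le_trans (rnorm_coord _ _) _; apply: le_trans (oproj_contract _ _ _) _.
rewrite /F /= /pisum (bigD1 j)//= big1 ?addr0; last first.
  by move=> k kj; rewrite /single (negbTE kj); exact: (cf0r (hform H)).
by rewrite /single eqxx rinnerE.
Qed.

Lemma oproj_entry v i : oproj F hS v i = \sum_j entry i j (v j).
Proof.
have vE : v = \sum_j single j (v j).
  apply/funext => k; rewrite fct_sumE (bigD1 k)//= big1 ?addr0.
    by rewrite /single eqxx.
  by move=> j jk; rewrite /single eq_sym (negbTE jk).
rewrite {1}vE (big_morph _ (oprojD F hS) (linear_zero (oproj_linear F hS Si))).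
by rewrite fct_sumE.
Qed.

End Entries.

Section Main.
Variables (R : realType) (G H : hilbertType R) (B : set (G -> G)).
Variables (E : completeNormedModType R[i]) (M : hilbertModule B E).
Variable T : interior_tensor M H.
Hypotheses (hB : von_neumann_algebra B) (hBG : nondegenerate_on B).
Implicit Types (x y : E) (g : G).

(** Passing to adjoints, [g] is orthogonal to every [b k], and these vectors are total. *)
Lemma nondegenerate_ker g : (forall b, B b -> b g = 0) -> g = 0.
Proof.
move=> bg0; pose e (p : {b | B b} * G) := sval p.1 p.2.
have eT : total_set (range e).
  suff -> : range e = [set b g | b in B & g in [set: G]] by [].
  apply/seteqP; split=> [_ [[[b Bb] k] _ <-]|_ [b Bb [k _ <-]]].
    by exists b => //; exists k.
  by exists (exist _ b Bb, k).
apply: (total_ext eT) => -[[b Bb] k]; rewrite /e /= inner0r.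
have [c Bc bc] := vna_adj hB Bb.
by rewrite innerC bc bg0// inner0l conjc0.
Qed.

Section Amplification.
Variables (n : nat) (v : 'I_n -> G).
Let FG := piform (hform G) n.
Let FH := piform (hform H) n.

Definition vB := [set (fun i => b (v i)) | b in B].
Definition vE := [set (fun i => odot T x (v i)) | x in [set: E]].

Lemma vB_subspace : real_subspace vB.
Proof.
split=> [|t _ _ [b Bb <-] [b' Bb' <-]]; first by exists 0 => //; exact: vna_0.
by exists (t%:C *: b + b') => //; exact: vna_lin.
Qed.

Lemma vB_i s : vB s -> vB ('i *: s).
Proof.
move=> [b Bb <-]; exists ('i *: b) => //.
by rewrite -[_ *: b]addr0; apply: vna_lin => //; exact: vna_0.
Qed.

Lemma vE_subspace : real_subspace vE.
Proof.
split=> [|t _ _ [x _ <-] [x' _ <-]].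
  exists 0 => //; apply/funext => i.
  exact: (linear_zero (odot_linearl T (v i))).
exists (t%:C *: x + x') => //; apply/funext => i; exact: odot_linearl.
Qed.

Lemma vE_i s : vE s -> vE ('i *: s).
Proof.
move=> [x _ <-]; exists ('i *: x) => //.
apply/funext => i; exact: (linear_scale (odot_linearl T (v i))).
Qed.

Let p := oproj FG vB_subspace.
Let q := oproj FH vE_subspace.

Let FG_op (b c : G -> G) (w w' : 'I_n -> G) : adjoint_ops b c ->
  FG w (fun i => b (w' i)) = FG (fun i => c (w i)) w'.
Proof.
move=> bc; rewrite /FG /= /pisum; apply: eq_bigr => i _.
by rewrite (adjoint_opsE _ _ bc).
Qed.

Let amp_bound (H1 H2 : hilbertType R) (f : H1 -> H2) : bounded_ops H1 H2 f ->
  exists C : R, forall w : 'I_n -> H1,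
  piform (hform H2) n (fun i => f (w i)) (fun i => f (w i)) <=
  C * piform (hform H1) n w w.
Proof.
move=> /bounded_opsP[_ [C C0 fC]]; exists (C ^+ 2) => w.
rewrite /= /pisum mulr_sumr; apply: ler_sum => i _.
rewrite !hform_norm -exprMn ler_pXn2r// ?nnegrE ?mulr_ge0 ?rnorm_ge0//.
exact: ltW.
Qed.

(** [vB] is invariant under [b] by closure under products, and its orthogonal complement because the
    adjoint of [b] is in [B]. *)
Lemma oproj_vB_comm b w : B b -> p (fun i => b (w i)) = fun i => b (p w i).
Proof.
move=> Bb; have bb := vna_bounded hB Bb; have [C fC] := amp_bound bb.
have /bounded_opsP[lb _] := bb.
symmetry; apply: (@oproj_commute _ _ _ FG FG vB vB vB_subspace vB_subspace
  (fun w i => b (w i)) C w) => //.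
- by move=> u u'; apply/funext => i; exact: (linear_sub lb).
- move=> _ [b' Bb' <-]; exists (b \o b') => //; exact: vna_comp.
- move=> u uo _ [b' Bb' <-]; have [c Bc bc] := vna_adj hB Bb.
  rewrite (FG_op _ _ bc); apply: uo; exists (c \o b') => //; exact: vna_comp.
Qed.

(* The components of v - p v are killed by B, hence vanish. *)
Lemma oproj_vB_id : p v = v.
Proof.
apply/esym/subr0_eq/funext => i; apply: nondegenerate_ker => b Bb.
have /bounded_opsP[lb _] := vna_bounded hB Bb.
have -> : b ((v - p v) i) = b (v i) - b (p v i) by exact: (linear_sub lb).
have := oproj_vB_comm v Bb => /(congr1 (fun f => f i)) /= <-.
rewrite [p _](_ : _ = fun i => b (v i)) ?subrr//.
apply: oproj_unique; first by apply: cl_sub; exists b.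
by move=> s _; rewrite subrr cf0r.
Qed.

Lemma oproj_Lop x w : q (fun i => odot T x (w i)) = fun i => odot T x (p w i).
Proof.
have bx := bounded_Lop T hB x; have [C fC] := amp_bound bx.
symmetry; apply: (@oproj_commute _ _ _ FG FH vB vE vB_subspace vE_subspace
  (fun w i => odot T x (w i)) C w) => //.
- by move=> u u'; apply/funext => i; exact: (linear_sub (odot_linearr T hB x)).
(* The identity behind this is x (.) bg = xb (.) g. *)
- move=> _ [b Bb <-]; exists (hm_act M x b) => //; apply/funext => i.
  apply: (odot_ext (T := T)) => y k.
  by rewrite !odot_inner hm_inner_act.
- move=> u uo _ [y _ <-].
  (* This is [L_x^* L_y = <x, y>] read coordinatewise; as [<x, y>] is in [B], the right-hand side
     pairs [u] with an element of [vB]. *)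
  have -> : FH (fun i => odot T y (v i)) (fun i => odot T x (u i)) =
     FG (fun i => hm_inner M x y (v i)) u.
    rewrite /FH /FG /= /pisum; apply: eq_bigr => i _.
    by rewrite /= /rinner odot_inner hm_inner_swap.
  by apply: uo; exists (hm_inner M x y) => //; exact: hm_innerB.
Qed.

Lemma entry_commutant i j : commutant B (entry vB_subspace i j).
Proof.
split; first exact: entry_bounded vB_i _ _.
move=> b Bb; apply/funext => g /=; rewrite /entry.
have /bounded_opsP[lb _] := vna_bounded hB Bb.
have /(congr1 (fun f => f i)) /= <- := oproj_vB_comm (single j g) Bb.
congr (oproj _ _ _ _); apply/funext => k; rewrite /single.
by case: ifP => //; rewrite (linear_zero lb).
Qed.

(** [oproj_Lop] at a vector supported in coordinate [j] shows that the entry of [q] acts on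
    elementary tensors as [rho'] prescribes. *)
Lemma rho'_entry i j : rho' T (entry vB_subspace i j) = entry vE_subspace i j.
Proof.
apply: tensor_opP; first exact: entry_bounded vE_i _ _.
move=> x g; rewrite /entry.
have /(congr1 (fun f => f i)) /= <- := oproj_Lop x (single j g).
congr (oproj _ _ _ _); apply/funext => k; rewrite /single.
by case: ifP => //; rewrite (linear_zero (odot_linearr T hB x)).
Qed.

Lemma intertwiner_cl z : intertwiners T z -> cl FH vE (fun i => z (v i)).
Proof.
move=> [/bounded_opsP[lz _] zB].
suff <- : q (fun i => z (v i)) = fun i => z (v i) by exact: oproj_cl.
apply/funext => i; rewrite /q (oproj_entry _ vE_i).
rewrite -[in RHS]oproj_vB_id /p (oproj_entry _ vB_i) (linear_bigsum lz).
apply: eq_bigr => j _; rewrite -rho'_entry.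
by have /(congr1 (fun f => f (v j))) := zB _ (entry_commutant i j).
Qed.

End Amplification.

Hypothesis hE : von_neumann_module T.

Lemma E_opsE : E_ops T = intertwiners T.
Proof.
apply/seteqP; split; first exact: E_ops_intertwiners.
move=> z hz; apply: hE; split; last exact: hz.1.
apply: ptws_closureP => s e e0.
(* The test vectors in [s] form one vector of the amplification; the tolerance is squared because
   forms are squared norms. *)
have [_ [x _ <-] zx] := @intertwiner_cl _ (fun i : 'I_(size s) => s`_i) z hz
  (e ^+ 2) (exprn_gt0 _ e0).
exists (Lop T x); first by exists x.
move=> g gs; have gi : (index g s < size s)%N by rewrite index_mem.
rewrite -(@ltr_pXn2r _ 2)// ?nnegrE ?rnorm_ge0 ?(ltW e0)//.
rewrite -[g](nth_index 0 gs).
exact: le_lt_trans (rnorm_coord _ (Ordinal gi)) zx.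
Qed.

(** The adjoint of [rho' T b'] acts on elementary tensors by [c'], which identifies it. *)
Lemma rho'_adj b' c' : commutant B b' -> adjoint_ops b' c' ->
  adjoint_ops (rho' T b') (rho' T c').
Proof.
move=> hb' bc; have [r br ar] := adjoint_ops_ex (rho'_bounded T hB hb').
suff -> : rho' T c' = r by [].
apply: tensor_opP => // x g; apply: (odot_ext (T := T)) => y k.
rewrite innerC -ar -innerC rho'_odot// !odot_inner !hm_inner_swap.
have /(congr1 (fun f => f k)) /= <- := hb'.2 _ (hm_innerB M x y).
by rewrite innerC bc -innerC.
Qed.

Lemma commutant_Ba_ops :
  commutant [set rho' T b' | b' in commutant B] `<=` Ba_ops T.
Proof.
(* Such an [f] makes each [f \o Lop T x] an intertwiner, hence some [Lop T y]; choosing [y] for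
   every [x] defines [a]. *)
have LE f : bounded_ops H H f ->
    (forall b', commutant B b' -> f \o rho' T b' = rho' T b' \o f) ->
    exists a, forall x g, f (odot T x g) = odot T (a x) g.
  move=> bf fr; have /choice[a aP] : forall x, exists y, forall g,
      f (odot T x g) = odot T y g.
    move=> x; suff : E_ops T (f \o Lop T x).
      by move=> [y _ yf]; exists y => g; have /(congr1 (fun f => f g)) := yf.
    rewrite E_opsE; split; first exact: bounded_ops_comp (bounded_Lop T hB x).
    move=> b' hb'; apply/funext => g /=.
    have /(congr1 (fun f => f (Lop T x g))) /= <- := fr _ hb'.
    by rewrite /Lop rho'_odot.
  by exists a.
move=> f [bf fr]; have [f' bf' ff'] := adjoint_ops_ex bf.
have [|a aP] := LE f bf; first by move=> b' hb'; apply: fr; exists b'.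
(* The adjoint of [f] also commutes with the representation, since the range of [rho'] on the
   commutant is closed under adjoints. *)
have [|a' a'P] := LE f' bf'.
  move=> b' hb'; have [c hc bc] := commutant_adj hB hb'.
  have rc := rho'_adj hb' bc.
  apply/funext => h; apply: (@cf_ext _ _ (hform H)) => k /=.
  rewrite /rinner; congr complex.Re; rewrite innerC -ff' -innerC rc.
  have /(congr1 (fun f => f k)) /= <- := fr _ (ex_intro2 _ _ c hc erefl).
  by rewrite [RHS]rc [RHS]innerC -ff' -innerC.
exists a; last exact: tensor_opP.
(* The adjoint relation between [a] and [a'] is that between [f] and [f'] tested on elementary
   tensors. *)
exists a' => x y; apply/funext => g; apply: (@cf_ext _ _ (hform G)) => k.
rewrite /= /rinner; congr complex.Re.
by rewrite -!(odot_inner T) -aP -a'P ff'.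
Qed.

End Main.

Theorem proposition2p2 (R : realType) (G : hilbertType R) (B : set (G -> G))
  (hB : von_neumann_algebra B) (hBG : nondegenerate_on B)
  (E : completeNormedModType R[i]) (M : hilbertModule B E)
  (H : hilbertType R) (T : interior_tensor M H)
  (hE : von_neumann_module T) :
  E_ops T = intertwiners T /\
  Ba_ops T = commutant [set rho' T b' | b' in commutant B].
Proof.
split; first exact: E_opsE.
by apply/seteqP; split; [exact: Ba_ops_commutant|exact: commutant_Ba_ops].
Qed.
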